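(* Let $T\subset\mathbb{R}^2$ be a triangle. Let $\mathcal{S}=(X(h))_{h\ge0}$ be either (a) a digital $(t,2)$-sequence over $\mathbb{F}_2$ (for some integer $t\ge 0$) with upper triangular generating matrices $C_1,C_2$, or (b) the digital sequence over $\mathbb{F}_2$ whose generating matrices $C_1=(c^{(1)}_{kl})$, $C_2=(c^{(2)}_{kl})$ are given by $c^{(1)}_{kl}=1$ if $l=2k-1$ and $0$ otherwise, and $c^{(2)}_{kl}=1$ if $l=2k$ and $0$ otherwise ($k,l\in\mathbb{N}$). Let $\mathcal{S}_T=(\phi^{(\nu(h))}(X(h)))_{h\ge 0}$ be the associated sequence of points in $T$, and let $P_N$ denote the first $N$ elements of $\mathcal{S}_T$. Then there is a constant $C>0$, independent of $f$, $N$ and $m$, such that for any $f\in C^2(T)$ the following hold: 1. For all integers $N\ge 2$, $$|I(f;P_N)-I(f)|\le C\,\|f\|_{C^2(T)}\frac{(\log_2N)^3}{N}.$$ 2. For all integers $m\ge 1$, $$|I(f;P_{2^m})-I(f)|\le C\,\|f\|_{C^2(T)}\frac{m^2}{2^m}.$$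
   Context: **Function space and quadrature.** $C^2(T)$ is the space of real-valued twice continuously differentiable functions on the closed triangle $T$ (derivatives up to order 2 continuous up to the boundary), with $\|f\|_{C^2(T)}:=\max_{0\le\delta_1+\delta_2\le 2}\|\partial^{\delta_1+\delta_2}f/\partial x_1^{\delta_1}\partial x_2^{\delta_2}\|_{L^\infty(T)}$. $I(f)=\frac{1}{|T|}\int_T f(\boldsymbol{x})\,d\boldsymbol{x}$, and for points $P_N=\{\boldsymbol{x}_0,\ldots,\boldsymbol{x}_{N-1}\}$ (counted with multiplicity) $I(f;P_N)=\frac1N\sum_{n=0}^{N-1}f(\boldsymbol{x}_n)$. **Recursive partitioning.** $\triangle(A,B,C)$ denotes the closed triangle with (ordered) vertices $A,B,C$. For $T=\triangle(A,B,C)$ and $(\xi_1,\xi_2)\in\mathbb{F}_2^2$ put $T^{(1)}(0,0)=\triangle(\frac{B+C}2,\frac{C+A}2,\frac{A+B}2)$, $T^{(1)}(1,0)=\triangle(A,\frac{A+B}2,\frac{A+C}2)$, $T^{(1)}(0,1)=\triangle(\frac{B+A}2,B,\frac{B+C}2)$, $T^{(1)}(1,1)=\triangle(\frac{C+A}2,\frac{C+B}2,C)$. For $X\in\mathbb{F}_2^{n\times2}$ with rows $\boldsymbol{\xi}_1,\ldots,\boldsymbol{\xi}_n$, define recursively $T^{(n)}(X)=\big(T^{(n-1)}(\boldsymbol{\xi}_1,\ldots,\boldsymbol{\xi}_{n-1})\big)^{(1)}(\boldsymbol{\xi}_n)$, with $T^{(0)}=T$. $\phi^{(n)}(X)$ is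 the center (centroid) of $T^{(n)}(X)$ (so $\phi^{(0)}$ is the center of $T$). If $X$ has more than $i$ rows (possibly infinitely many), $T^{(i)}(X)$ and $\phi^{(i)}(X)$ are computed from the first $i$ rows of $X$. **Digital nets and sequences.** For $m,n\in\mathbb{N}$, $n\ge m$, and $C_1,C_2\in\mathbb{F}_2^{n\times m}$, the digital net with generating matrices $C_1,C_2$ is $P=\{X(h):0\le h<2^m\}\subset\mathbb{F}_2^{n\times2}$, where for $h=\eta_0+\eta_1 2+\cdots+\eta_{m-1}2^{m-1}$ the $j$-th column of $X(h)$ is $C_j(\eta_0,\ldots,\eta_{m-1})^\top$, $j=1,2$. Its dual net is $P^\perp=\{K=(k_1,k_2)\in\mathbb{F}_2^{n\times2}: C_1^\top k_1\oplus C_2^\top k_2=\boldsymbol{0}\in\mathbb{F}_2^m\}$, where $k_1,k_2\in\mathbb F_2^n$ are the columns of $K$. For a column $k=(\kappa_1,\kappa_2,\ldots)^\top$ with finitely many nonzero entries, $\mu_1(k)=\max\{i:\kappa_i\ne0\}$ and $\mu_1(\boldsymbol{0})=0$; $\mu_1(K)=\mu_1(k_1)+\mu_1(k_2)$; $\mu_1(P^\perp)=\min_{K\in P^\perp\setminus\{\boldsymbol{0}\}}\mu_1(K)$. $P$ is a digital $(t,m,2)$-net over $\mathbb{F}_2$ if $\mu_1(P^\perp)\ge m-t+1$. A digital sequence over $\mathbb{F}_2$ with generating matrices $C_1,C_2\in\mathbb{F}_2^{\mathbb{N}\times\mathbb{N}}$ (where each column of $C_j$ has only finitely many nonzero entries)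 is the sequence $X(h)\in\mathbb{F}_2^{\mathbb{N}\times2}$, $h\ge0$, whose $j$-th column is $C_j(\eta_0,\eta_1,\ldots)^\top$, where $h=\eta_0+\eta_12+\cdots$ is the (finite) dyadic expansion. For each $m$, its first $2^m$ elements are regarded as the digital net with generating matrices $C_1^{n\times m},C_2^{n\times m}$ (left upper $n\times m$ submatrices), for some $n\ge m$ beyond which all rows of the first $m$ columns vanish. It is a digital $(t,2)$-sequence if for every $m>t$ its first $2^m$ elements form a digital $(t,m,2)$-net. $C_j=(c^{(j)}_{kl})$ is upper triangular if $c^{(j)}_{kl}=0$ for $k>l$. $\nu(h)\in\mathbb{N}_0$ is the smallest integer such that all rows of $X(h)$ with index greater than $\nu(h)$ are zero. *)

(* Defs.v *)
From mathcomp Require Export all_boot all_order all_algebra.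
From mathcomp Require Export all_classical all_reals all_analysis.
Export Order.TTheory GRing.Theory Num.Theory numFieldNormedType.Exports.

Set Implicit Arguments.
Unset Strict Implicit.
Unset Printing Implicit Defensive.

Global Open Scope classical_set_scope.
Global Open Scope ring_scope.

Record triangle (R : realType) :=
  Triangle { vA : (R * R)%type; vB : (R * R)%type; vC : (R * R)%type }.

Definition nondegenerate (R : realType) (T : triangle R) : Prop :=
  ((vB T).1 - (vA T).1) * ((vC T).2 - (vA T).2)
    - ((vC T).1 - (vA T).1) * ((vB T).2 - (vA T).2) != 0.

Definition triangle_set (R : realType) (T : triangle R) : set (R * R) :=
  [set x | exists a b c : R, [/\ 0 <= a, 0 <= b, 0 <= c, a + b + c = 1
    & x = a *: vA T + b *: vB T + c *: vC T]].

Definition midpoint (R : realType) (P Q : R * R) : R * R := 2^-1 *: (P + Q).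

Definition center (R : realType) (T : triangle R) : R * R :=
  3^-1 *: (vA T + vB T + vC T).

Definition row2 : Type := ('F_2 * 'F_2)%type.

Definition subtriangle (R : realType) (T : triangle R) (xi : row2) : triangle R :=
  let: Triangle A B C := T in
  if xi == (0, 0) then Triangle (midpoint B C) (midpoint C A) (midpoint A B)
  else if xi == (1, 0) then Triangle A (midpoint A B) (midpoint A C)
  else if xi == (0, 1) then Triangle (midpoint B A) B (midpoint B C)
  else Triangle (midpoint C A) (midpoint C B) C.

(* All rows and columns are numbered from 0: X i is the row of index i + 1 in
   the usual numbering, and C k l is the entry of row k + 1, column l + 1. *)

Fixpoint subtriangle_iter (R : realType) (T : triangle R) (X : nat -> row2)
    (n : nat) : triangle R :=
  if n is n'.+1 then subtriangle (subtriangle_iter T X n') (X n') else T.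

Definition phi (R : realType) (T : triangle R) (n : nat) (X : nat -> row2) :
  R * R := center (subtriangle_iter T X n).

(* mu_1(k): the 1-based index of the last nonzero entry of k, and 0 for k = 0 *)
Definition mu1_col (n : nat) (k : 'cV['F_2]_n) : nat :=
  \max_(i < n | k i 0 != 0) i.+1.

Definition mu1 (n : nat) (K : 'cV['F_2]_n * 'cV['F_2]_n) : nat :=
  (mu1_col K.1 + mu1_col K.2)%N.

Definition dual_net (n m : nat) (C1 C2 : 'M['F_2]_(n, m)) :
    {set 'cV['F_2]_n * 'cV['F_2]_n} :=
  [set K | C1^T *m K.1 + C2^T *m K.2 == 0].

(* The minimum of mu1 over the nonzero elements of the dual net; 2n is an upper
   bound of mu1, so starting the minimum from it does not change the value. *)
Definition mu1_dual (n m : nat) (C1 C2 : 'M['F_2]_(n, m)) : nat :=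
  \big[minn/(2 * n)%N]_(K in dual_net C1 C2 :\ (0, 0)) mu1 K.

(* The second condition is mu_1 >= m - t + 1, without truncated subtraction. The
   net property depends on the net only through its generating matrices. *)
Definition digital_net (t n m : nat) (C1 C2 : 'M['F_2]_(n, m)) : Prop :=
  (m <= n)%N /\ (m + 1 <= mu1_dual C1 C2 + t)%N.

Definition infmx : Type := nat -> nat -> 'F_2.

Definition finite_columns (C : infmx) : Prop :=
  forall l, exists n, forall k, (n <= k)%N -> C k l = 0.

Definition upper_triangular (C : infmx) : Prop :=
  forall k l, (l < k)%N -> C k l = 0.

Definition submatrix (n m : nat) (C : infmx) : 'M['F_2]_(n, m) :=
  \matrix_(k < n, l < m) C k l.

Definition digital_ts_sequence (t : nat) (C1 C2 : infmx) : Prop :=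
  [/\ finite_columns C1, finite_columns C2 &
      forall m, (t < m)%N -> exists n, [/\ (m <= n)%N,
        (forall k l, (n <= k)%N -> (l < m)%N -> C1 k l = 0 /\ C2 k l = 0) &
        digital_net t (submatrix n m C1) (submatrix n m C2)]].

(* eta_l, where h = eta_0 + eta_1 2 + eta_2 2^2 + ... *)
Definition bit (h l : nat) : 'F_2 := (h %/ 2 ^ l %% 2)%N%:R.

(* The sum stops at l < h because h < 2 ^ h, so eta_l = 0 for l >= h. *)
Definition digital_point (C1 C2 : infmx) (h : nat) : nat -> row2 :=
  fun k => (\sum_(l < h) C1 k l * bit h l, \sum_(l < h) C2 k l * bit h l).

Definition rows_vanish_from (X : nat -> row2) (n : nat) : Prop :=
  forall i, (n <= i)%N -> X i = (0, 0).

(* The least n such that all rows of 1-based index > n vanish; the default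
   value 0 is used only if X has infinitely many nonzero rows. *)
Definition nu (X : nat -> row2) : nat :=
  xget 0%N [set n | rows_vanish_from X n /\
                    forall n', rows_vanish_from X n' -> (n <= n')%N].

Definition triangle_sequence (R : realType) (T : triangle R) (C1 C2 : infmx)
    (h : nat) : R * R :=
  let X := digital_point C1 C2 h in phi T (nu X) X.

(* c1_{kl} = 1 iff l = 2k - 1, and c2_{kl} = 1 iff l = 2k, for the 1-based
   indices k.+1 and l.+1 *)
Definition interlaced1 : infmx := fun k l => (l.+1 == 2 * k.+1 - 1)%N%:R.
Definition interlaced2 : infmx := fun k l => (l.+1 == 2 * k.+1)%N%:R.

Definition lebesgue2 (R : realType) :
    {measure set (measurableTypeR R * measurableTypeR R) -> \bar R} :=
  (@lebesgue_measure R \x @lebesgue_measure R)%E.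
Arguments lebesgue2 R : clear implicits.

Definition mean_integral (R : realType) (T : triangle R) (f : R * R -> R) : R :=
  (fine (lebesgue2 R (triangle_set T)))^-1
  * \int[lebesgue2 R]_(x in triangle_set T) f x.

Definition quadrature (R : realType) (f : R * R -> R) (x : nat -> R * R)
  (N : nat) : R := N%:R^-1 * \sum_(n < N) f (x n).

Definition partial (R : realType) (d1 d2 : nat) (f : R * R -> R) : R * R -> R :=
  iter d1 (fun g x => 'D_((1, 0) : R * R) g x)
    (iter d2 (fun g x => 'D_((0, 1) : R * R) g x) f).

(* f is C^2 on the closed set D, the closure of its interior: f is continuous
   on D, the partial derivatives of order <= 2 exist in the interior of D, and
   each of them extends continuously to D. Only the values of f on D matter. *)
Definition C2_on (R : realType) (D : set (R * R)) (f : R * R -> R) : Prop :=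
  [/\ {within D, continuous f},
      (forall d1 d2, (d1 + d2 <= 1)%N -> forall x, D° x ->
         derivable (partial d1 d2 f) x (1, 0) /\
         derivable (partial d1 d2 f) x (0, 1)) &
      (forall d1 d2, (d1 + d2 <= 2)%N ->
         exists2 g : R * R -> R, {within D, continuous g} &
           forall x, D° x -> partial d1 d2 f x = g x)].

(* The maximum of the L^oo norms of the partial derivatives of order <= 2. The
   derivatives are restricted to the interior of D, where they are meaningful;
   for a triangle, the boundary is a null set. *)
Definition C2_norm (R : realType) (D : set (R * R)) (f : R * R -> R) : \bar R :=
  \big[maxe/0%E]_(d : 'I_3 * 'I_3 | (d.1 + d.2 <= 2)%N)
    'N[lebesgue2 R]_+oo[EFin \o (partial d.1 d.2 f \_ D°)]%E.

Definition log2 (R : realType) (x : R) : R := ln x / ln 2.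

(* Main.v *)
From mathcomp Require Import ring lra zify measurable_realfun measure_function ess_sup_inf.
Require Import Defs.
Set Implicit Arguments.
Unset Strict Implicit.
Unset Printing Implicit Defensive.

(* Since the medial triangle has the centroid of its parent, the centers satisfy
     phi_(r+1) = phi_r + s_r 2^-(r+1) a(xi_r),
   where xi_r is the row of index r, a(0,0) = 0, a takes the values vertex - center of T on the other
   rows, and s_r is the product over i < r of the signs -1 (if xi_i = (0,0)) or 1.
   A block of 2^m consecutive points of the sequence makes the rows affine functions of m bits; for some
   d with 4^d of order 2^m, the first d rows are jointly uniform. On the block, the mean of f(phi_d) is
   then the composite centroid rule of level d, with error O(4^-d). For r >= d the increment
   f(phi_(r+1)) - f(phi_r) is s_r 2^-(r+1) (grad f)(phi_r) . a(xi_r) up to O(4^-r), and its mean over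
   the block is controlled by Walsh analysis: the signs of the rows beyond d have Walsh l^1 norm 2,
   whereas each sign of a free row has all its Walsh coefficients equal to 1/2 in absolute value.
   Splitting (grad f)(phi_r) along the levels j <= d, with increments O(2^-j), bounds this mean by
   O(d 4^-d). Summation over d <= r < M gives an error O(d M 4^-d) on a block, and a dyadic
   decomposition of [0, N) adds one more logarithm. *)

(** * Recursive subdivision of a triangle *)

Section Geometry.
Variable R : realType.
Implicit Types (T : triangle R) (x p q w : R * R) (xi : row2) (X : nat -> row2).

(** The obstacle is that only about half of the digits of a block give free rows: two matrices share
    m digits, and d rows of each use up 2d of them, so d is close to m / 2. Since phi_M and phi_d
    may differ by a multiple of 2^-d, a triangle inequality gives only the square root of the
    desired rate; the missing factor 2^-d must come from cancellation in the signs s_r. About the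
    rows beyond d nothing is known except that they are affine in the digits. Their signs cost
    2^(r-d), which is exactly what the displacement 2^-(r+1) pays for, and what remains is 2^-d from
    the displacement times 2^-d from the free signs. Both kinds of sequence enter through the same
    two properties: independence of the first d rows with m <= 2d + t, and upper triangularity,
    which allows nu(h) to be replaced by a level common to all points of a block. Derivatives are
    controlled in the interior only. All centers lie in an explicit open triangle, where the Taylor
    estimates are made; the boundary matters only for the integral, through a Lipschitz constant
    that disappears in a limit. *)

Lemma pair_ext p q : p.1 = q.1 -> p.2 = q.2 -> p = q.
Proof. by case: p q => [? ?] [? ?] /= -> ->. Qed.

Lemma pair_eqE p q : p = q -> p.1 = q.1 /\ p.2 = q.2.
Proof. by move->. Qed.

Lemma fstD p q : (p + q).1 = p.1 + q.1. Proof. by []. Qed.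
Lemma sndD p q : (p + q).2 = p.2 + q.2. Proof. by []. Qed.
Lemma fstN p : (- p).1 = - p.1. Proof. by []. Qed.
Lemma sndN p : (- p).2 = - p.2. Proof. by []. Qed.
Lemma fstZ (a : R) p : (a *: p).1 = a * p.1. Proof. by []. Qed.
Lemma sndZ (a : R) p : (a *: p).2 = a * p.2. Proof. by []. Qed.
Lemma fst0 : (0 : R * R).1 = 0. Proof. by []. Qed.
Lemma snd0 : (0 : R * R).2 = 0. Proof. by []. Qed.
Definition pairE := (fst0, snd0, fstD, sndD, fstN, sndN, fstZ, sndZ).

Lemma prod_norm p : `|p| = Num.max `|p.1| `|p.2|. Proof. by []. Qed.
Lemma norm_fst p : `|p.1| <= `|p|. Proof. by rewrite prod_norm le_max lexx. Qed.
Lemma norm_snd p : `|p.2| <= `|p|. Proof. by rewrite prod_norm le_max lexx orbT. Qed.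
Lemma prod_norm_le p (e : R) : (`|p| <= e) = (`|p.1| <= e) && (`|p.2| <= e).
Proof. by rewrite prod_norm ge_max. Qed.

Lemma ball_prodP p q (e : R) : ball p e q <-> `|p.1 - q.1| < e /\ `|p.2 - q.2| < e.
Proof.
have -> : ball p e q = (ball p.1 e q.1 /\ ball p.2 e q.2) by [].
by rewrite -!ball_normE.
Qed.

Lemma row2_ind (P : row2 -> Prop) :
  P (0, 0) -> P (1, 0) -> P (0, 1) -> P (1, 1) -> forall xi, P xi.
Proof.
move=> h0 h1 h2 h3 [[[|[|i]] hi] [[|[|j]] hj]] //=.
- by have -> : (Ordinal hi, Ordinal hj) = (0, 0) :> row2 by congr pair; apply: val_inj.
- by have -> : (Ordinal hi, Ordinal hj) = (0, 1) :> row2 by congr pair; apply: val_inj.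
- by have -> : (Ordinal hi, Ordinal hj) = (1, 0) :> row2 by congr pair; apply: val_inj.
- by have -> : (Ordinal hi, Ordinal hj) = (1, 1) :> row2 by congr pair; apply: val_inj.
Qed.

(** The sign of the homothety ratio from the parent to the child: corner children have ratio 1/2,
    the central child is reversed and has ratio -1/2. *)
Definition row_sign xi : R := if xi == (0, 0) then -1 else 1.

Definition row_shift T xi : R * R :=
  if xi == (0, 0) then 0
  else if xi == (1, 0) then vA T - center T
  else if xi == (0, 1) then vB T - center T
  else vC T - center T.

Definition prefix_sign X r : R := \prod_(i < r) row_sign (X i).

Lemma eq_subtriangle_iter T X X' n : (forall i, (i < n)%N -> X i = X' i) ->
  subtriangle_iter T X n = subtriangle_iter T X' n.
Proof.
elim: n => //= n IH E; rewrite E//; congr subtriangle; apply: IH => i ni.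
by apply: E; exact: ltnW.
Qed.

Lemma homothetic_subtriangle T Y xi (k : R) :
  vA Y = center Y + k *: (vA T - center T) ->
  vB Y = center Y + k *: (vB T - center T) ->
  vC Y = center Y + k *: (vC T - center T) ->
  let Z := subtriangle Y xi in
  [/\ vA Z = center Z + (row_sign xi * (k / 2)) *: (vA T - center T),
      vB Z = center Z + (row_sign xi * (k / 2)) *: (vB T - center T),
      vC Z = center Z + (row_sign xi * (k / 2)) *: (vC T - center T) &
      center Z = center Y + (k / 2) *: row_shift T xi].
Proof.
have S0 : (vA T - center T) + (vB T - center T) + (vC T - center T) = 0.
  by apply: pair_ext; rewrite /center !pairE /=; field.
rewrite /row_shift; move: S0.
move: (vA T - center T) (vB T - center T) (vC T - center T) => a b c.
(* The vectors from the centroid to the vertices sum to zero. Eliminating the third makes all claims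
   linear in the first two. *)
case: Y => A B C /= S0; have -> : c = - a - b.
  by apply/eqP; rewrite -opprD -addr_eq0 addrC S0.
rewrite /center /= => EA EB EC.
have [[A1 A2] [B1 B2]] := (pair_eqE EA, pair_eqE EB); have [C1 C2] := pair_eqE EC.
rewrite ?pairE in A1 A2 B1 B2 C1 C2; rewrite {EA EB EC}.
elim/row2_ind: xi; rewrite /row_sign /=; split; apply: pair_ext;
  rewrite /midpoint ?pairE; lra.
Qed.

Lemma subtriangle_iter_homothetic T X r : let Y := subtriangle_iter T X r in
  let k := prefix_sign X r / 2 ^+ r in
  [/\ vA Y = center Y + k *: (vA T - center T),
      vB Y = center Y + k *: (vB T - center T) &
      vC Y = center Y + k *: (vC T - center T)].
Proof.
elim: r => [|r [EA EB EC]] /=.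
  by rewrite /prefix_sign big_ord0 expr0 divr1 !scale1r !(addrC (center T)) !subrK.
have -> : prefix_sign X r.+1 / 2 ^+ r.+1 = row_sign (X r) * (prefix_sign X r / 2 ^+ r / 2).
  rewrite /prefix_sign big_ord_recr /= exprS; field; exact: expf_neq0.
by have [] := homothetic_subtriangle (X r) EA EB EC.
Qed.

Lemma phiS T X r :
  phi T r.+1 X = phi T r X + (prefix_sign X r / 2 ^+ r.+1) *: row_shift T (X r).
Proof.
have [EA EB EC] := subtriangle_iter_homothetic T X r.
have [_ _ _] := homothetic_subtriangle (X r) EA EB EC.
by rewrite /phi /= => ->; rewrite exprSr invfM mulrA.
Qed.

Lemma triangle_set_affine T T' (a : R) w : a != 0 ->
  vA T = a *: vA T' + w -> vB T = a *: vB T' + w -> vC T = a *: vC T' + w ->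
  triangle_set T' = (fun x => a *: x + w) @^-1` triangle_set T.
Proof.
move=> a0 EA EB EC; apply/seteqP; split=> x /= [u [v [t [hu hv ht S E]]]];
  exists u, v, t; split=> //.
  have Et : t = 1 - u - v by lra.
  by rewrite E EA EB EC Et; apply: pair_ext; rewrite !pairE; ring.
move/(congr1 (fun y => a^-1 *: (y - w))): E; rewrite addrK scalerA mulVf// scale1r => ->.
have Et : t = 1 - u - v by lra.
by apply: pair_ext; rewrite EA EB EC Et !pairE; field.
Qed.

(** The map sends the child back onto its parent, with ratio 2 at a corner and -2 for the reversed
    central child. Its Jacobian determinant is [a ^+ 2], so the child has a quarter of the area. *)
Lemma subtriangle_preimage T xi : exists (a : R) w, [/\ a ^+ 2 = 4 &
  triangle_set (subtriangle T xi) = (fun x => a *: x + w) @^-1` triangle_set T].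
Proof.
have n2 : (-2 : R) != 0 by rewrite oppr_eq0.
case: T => A B C; elim/row2_ind: xi => /=.
- exists (- 2), (A + B + C); split; first by ring.
  by apply: triangle_set_affine => //=; apply: pair_ext; rewrite /midpoint !pairE; field.
- exists 2, (- A); split; first by ring.
  by apply: triangle_set_affine => //=; apply: pair_ext; rewrite /midpoint !pairE; field.
- exists 2, (- B); split; first by ring.
  by apply: triangle_set_affine => //=; apply: pair_ext; rewrite /midpoint !pairE; field.
- exists 2, (- C); split; first by ring.
  by apply: triangle_set_affine => //=; apply: pair_ext; rewrite /midpoint !pairE; field.
Qed.

(** A barycentric coordinate that is at least 1/2 places the point in the child at that corner. If
    all are below 1/2, then 1 - 2a, 1 - 2b, 1 - 2c are coordinates in the central child. *)
Lemma triangle_set_cover T x : triangle_set T x -> exists xi, triangle_set (subtriangle T xi) x.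
Proof.
case: T => A B C [a [b [c [a0 b0 c0 S ->]]]].
have Ec : c = 1 - a - b by lra.
case: (lerP (1/2) a) => ha.
  exists (1, 0), (2 * a - 1), (2 * b), (2 * c); split; [lra|lra|lra|lra|].
  by apply: pair_ext; rewrite ?pairE /= /midpoint ?pairE Ec; field.
case: (lerP (1/2) b) => hb.
  exists (0, 1), (2 * a), (2 * b - 1), (2 * c); split; [lra|lra|lra|lra|].
  by apply: pair_ext; rewrite ?pairE /= /midpoint ?pairE Ec; field.
case: (lerP (1/2) c) => hc.
  exists (1, 1), (2 * a), (2 * b), (2 * c - 1); split; [lra|lra|lra|lra|].
  by apply: pair_ext; rewrite ?pairE /= /midpoint ?pairE Ec; field.
exists (0, 0), (1 - 2 * a), (1 - 2 * b), (1 - 2 * c); split; [lra|lra|lra|lra|].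
by apply: pair_ext; rewrite ?pairE /= /midpoint ?pairE Ec; field.
Qed.

Definition triangle_det T : R := ((vB T).1 - (vA T).1) * ((vC T).2 - (vA T).2)
    - ((vC T).1 - (vA T).1) * ((vB T).2 - (vA T).2).

(** Barycentric coordinates by Cramer's rule; [triangle_det] is twice the signed area. *)
Definition baryB T x : R := ((vC T).2 - (vA T).2) / triangle_det T * (x.1 - (vA T).1)
  - ((vC T).1 - (vA T).1) / triangle_det T * (x.2 - (vA T).2).
Definition baryC T x : R := ((vB T).1 - (vA T).1) / triangle_det T * (x.2 - (vA T).2)
  - ((vB T).2 - (vA T).2) / triangle_det T * (x.1 - (vA T).1).
Definition baryA T x : R := 1 - baryB T x - baryC T x.

(** An explicit convex open set inside the topological interior, given by inequalities; the
    estimates on derivatives are stated on it. *)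
Definition triangle_core T : set (R * R) :=
  [set x | [/\ 0 < baryA T x, 0 < baryB T x & 0 < baryC T x]].

Lemma bary_decomp T x : nondegenerate T ->
  x = baryA T x *: vA T + baryB T x *: vB T + baryC T x *: vC T.
Proof.
rewrite /nondegenerate -/(triangle_det T) /baryA /baryB /baryC => d0.
by apply: pair_ext; rewrite !pairE; move: d0; rewrite /triangle_det => d0; field.
Qed.

Lemma bary_comb T (a b c : R) : nondegenerate T -> a + b + c = 1 ->
  let x := a *: vA T + b *: vB T + c *: vC T in
  [/\ baryA T x = a, baryB T x = b & baryC T x = c].
Proof.
rewrite /nondegenerate -/(triangle_det T) => d0 S /=.
set x := (_ + _ + _).
have EB : baryB T x = b.
  rewrite /baryB /x !pairE; have -> : a = 1 - b - c by lra.
  by move: d0; rewrite /triangle_det => d0; field.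
have EC : baryC T x = c.
  rewrite /baryC /x !pairE; have -> : a = 1 - b - c by lra.
  by move: d0; rewrite /triangle_det => d0; field.
by rewrite /baryA EB EC; split => //; lra.
Qed.

Lemma triangle_setP T x : nondegenerate T ->
  triangle_set T x <-> [/\ 0 <= baryA T x, 0 <= baryB T x & 0 <= baryC T x].
Proof.
move=> hT; split=> [[a [b [c [a0 b0 c0 S ->]]]]|[a0 b0 c0]].
  by have [-> -> ->] := bary_comb hT S.
by exists (baryA T x), (baryB T x), (baryC T x); split => //; [rewrite /baryA; lra|exact: bary_decomp].
Qed.

Lemma triangle_core_sub T : nondegenerate T -> triangle_core T `<=` triangle_set T.
Proof. by move=> hT x [a b c]; apply/triangle_setP => //; split; exact: ltW. Qed.

Lemma continuous_affine_form (a b c : R) p : continuous (fun x : R * R => a * (x.1 - p.1) - b * (x.2 - p.2) + c).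
Proof.
move=> x; apply: cvgD; last exact: cvg_cst.
apply: cvgB; apply: cvgM; try exact: cvg_cst; apply: cvgB; try exact: cvg_cst.
  exact: cvg_fst.
exact: cvg_snd.
Qed.

Lemma continuous_baryA T : continuous (baryA T).
Proof.
have E : baryA T = (fun x => (((vB T).2 - (vA T).2) / triangle_det T - ((vC T).2 - (vA T).2) / triangle_det T) * (x.1 - (vA T).1)
  - (((vB T).1 - (vA T).1) / triangle_det T - ((vC T).1 - (vA T).1) / triangle_det T) * (x.2 - (vA T).2) + 1).
  by apply/funext => x; rewrite /baryA /baryB /baryC; ring.
by rewrite E; exact: continuous_affine_form.
Qed.
Lemma continuous_baryB T : continuous (baryB T).
Proof.
have E : baryB T = (fun x => (((vC T).2 - (vA T).2) / triangle_det T) * (x.1 - (vA T).1)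
  - (((vC T).1 - (vA T).1) / triangle_det T) * (x.2 - (vA T).2) + 0).
  by apply/funext => x; rewrite /baryB; ring.
by rewrite E; exact: continuous_affine_form.
Qed.
Lemma continuous_baryC T : continuous (baryC T).
Proof.
have E : baryC T = (fun x => (- (((vB T).2 - (vA T).2) / triangle_det T)) * (x.1 - (vA T).1)
  - (- (((vB T).1 - (vA T).1) / triangle_det T)) * (x.2 - (vA T).2) + 0).
  by apply/funext => x; rewrite /baryC; ring.
by rewrite E; exact: continuous_affine_form.
Qed.

Lemma open_triangle_core T : open (triangle_core T).
Proof.
have -> : triangle_core T = (baryA T @^-1` [set t | 0 < t]) `&` (baryB T @^-1` [set t | 0 < t])
   `&` (baryC T @^-1` [set t | 0 < t]).
  by apply/seteqP; split => x /=; [case|case; case].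
apply: openI; [apply: openI|]; apply: open_comp; try exact: open_gt; move=> x _.
- exact: continuous_baryA.
- exact: continuous_baryB.
- exact: continuous_baryC.
Qed.

Lemma closed_triangle_set T : nondegenerate T -> closed (triangle_set T).
Proof.
move=> hT; have -> : triangle_set T = (baryA T @^-1` [set t | 0 <= t]) `&` (baryB T @^-1` [set t | 0 <= t])
   `&` (baryC T @^-1` [set t | 0 <= t]).
  by apply/seteqP; split => x /=; [case/triangle_setP => //|case; case => *; apply/triangle_setP].
apply: closedI; [apply: closedI|]; apply: closed_comp; try exact: closed_ge; move=> x _.
- exact: continuous_baryA.
- exact: continuous_baryB.
- exact: continuous_baryC.
Qed.

Lemma triangle_core_interior T : nondegenerate T -> triangle_core T `<=` (triangle_set T)°.
Proof.
move=> hT; rewrite -open_subsetE; last exact: open_triangle_core.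
exact: triangle_core_sub.
Qed.

Lemma bary_convex T (t : R) p q :
  [/\ baryA T ((1 - t) *: p + t *: q) = (1 - t) * baryA T p + t * baryA T q,
      baryB T ((1 - t) *: p + t *: q) = (1 - t) * baryB T p + t * baryB T q &
      baryC T ((1 - t) *: p + t *: q) = (1 - t) * baryC T p + t * baryC T q].
Proof. by rewrite /baryA /baryB /baryC !pairE; split; ring. Qed.

End Geometry.

(** * Planar Lebesgue measure *)

Section Measure.
Variable R : realType.
Local Notation mu := (lebesgue2 R).
Local Notation R2 := (measurableTypeR R * measurableTypeR R)%type.

Lemma measurable_ball2 (p : R * R) e : measurable (ball p e : set R2).
Proof.
have -> : ball p e = ball p.1 e `*` ball p.2 e by [].
by apply: measurableX; apply: open_measurable; exact: ball_open.
Qed.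

(** An open set is a countable union of balls with rational center and radius, and a ball of the max
    norm is a measurable rectangle. *)
Lemma open_prod_measurable (O : set (R * R)) : open O -> measurable (O : set R2).
Proof.
move=> oO.
pose B (q : rat * rat * rat) : set R2 :=
  let b := ball ((ratr q.1.1, ratr q.1.2) : R * R) (ratr q.2) in
  if `[< b `<=` O >] then b else set0.
have -> : O = \bigcup_q B q.
  apply/seteqP; split => [[x y] Oxy|z [q _]]; last first.
    by rewrite /B; case: asboolP => // + bz; exact.
  have /nbhs_ballP[e /= e0 He] : nbhs ((x, y) : R * R) O by exact: open_nbhs_nbhs.
  (* With radius below e / 2, a ball containing (x, y) stays inside the ball of radius e around (x,
     y). *)
  have [q] := @rat_in_itvoo R 0 (e / 2) ltac:(lra).
  rewrite in_itv /= => /andP[q0 q1].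
  have [rx] := @rat_in_itvoo R (x - ratr q) (x + ratr q) ltac:(lra).
  rewrite in_itv /= => /andP[rx1 rx2].
  have [ry] := @rat_in_itvoo R (y - ratr q) (y + ratr q) ltac:(lra).
  rewrite in_itv /= => /andP[ry1 ry2].
  exists ((rx, ry), q) => //; rewrite /B /=; case: asboolP => [_|[]].
    by apply/ball_prodP => /=; rewrite !ltr_norml; lra.
  move=> [u v] /ball_prodP /=; rewrite !ltr_norml => -[hu hv].
  by apply: He; apply/ball_prodP => /=; rewrite !ltr_norml; lra.
apply: countable_bigcupT_measurable => // q.
by rewrite /B; case: asboolP => // _; exact: measurable_ball2.
Qed.

Lemma within_continuous_measurable (D : set (R * R)) (f : R * R -> R) :
  measurable (D : set R2) -> {within D, continuous f} ->
  measurable_fun (D : set R2) (f : R2 -> measurableTypeR R).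
Proof.
move=> mD /continuousP cf; apply: (measurability _ (RGenOpens.measurableE R)).
move=> _ [_ [a [b ->] <-]].
have /open_subspaceP[V oV VD] : open (from_subspace D f @^-1` `]a, b[%classic).
  by apply: cf; exact: interval_open.
rewrite setIC -VD; apply: measurableI => //; exact: open_prod_measurable.
Qed.

Lemma lebesgue2_ball (p : R * R) e : 0 <= e -> mu (ball p e) = ((e *+ 2) ^+ 2)%:E.
Proof.
move=> e0; have -> : ball p e = ball p.1 e `*` ball p.2 e by [].
rewrite /lebesgue2 /= product_measure1E; last 2 first.
- by apply: open_measurable; exact: ball_open.
- by apply: open_measurable; exact: ball_open.
have := lebesgue_measure_ball p.1 e0; have := lebesgue_measure_ball p.2 e0.
rewrite /= => -> ->; by rewrite -EFinM expr2.
Qed.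

Lemma preimage_affine_itv (a w x y : R) : a != 0 ->
  (fun t => a * t + w) @^-1` `]x, y]%classic =
  if 0 < a then `](x - w) / a, (y - w) / a]%classic
  else `[(y - w) / a, (x - w) / a[%classic.
Proof.
move=> a0; apply/seteqP; case: ifPn => a1; (have a2 : 0 < a \/ a < 0 by case: (ltgtP a 0) a0; auto);
  split => t /=; rewrite !in_itv /=.
- by rewrite ltr_pdivrMr// ler_pdivlMr//; lra.
- by rewrite ltr_pdivrMr// ler_pdivlMr//; lra.
- by case: a2 => [/[dup]|] a2; [rewrite (negbTE a1)|rewrite ltr_ndivlMr// ler_ndivrMr//; lra].
- by case: a2 => [/[dup]|] a2; [rewrite (negbTE a1)|rewrite ltr_ndivlMr// ler_ndivrMr//; lra].
Qed.

Lemma measurable_affine1 (a w : R) :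
  measurable_fun setT ((fun t : measurableTypeR R => a * t + w) : _ -> measurableTypeR R).
Proof.
apply: measurable_funD; last exact: measurable_cst.
by apply: measurable_funM; [exact: measurable_cst|exact: measurable_id].
Qed.

(** Packages the pushforward as a bundled measure known only through its values, ready for the
    uniqueness theorems below. *)
Lemma pushforward_measure_exists d1 d2 (T1 : measurableType d1) (T2 : measurableType d2)
  (m : {measure set T1 -> \bar R}) (f : T1 -> T2) :
  measurable_fun setT f -> exists m' : {measure set T2 -> \bar R}, forall X, m' X = m (f @^-1` X).
Proof. by move=> mf; unshelve eexists (pushforward m f : measure T2 R). Qed.

(** The pushforward scaled by |a| agrees with Lebesgue measure on half-open intervals, which
    determines it; for a < 0 the preimage is closed at the other end, with the same length. *)
Lemma lebesgue_preimage_affine (a w : R) (A : set (measurableTypeR R)) : a != 0 -> measurable A ->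
  (`|a|%:E * lebesgue_measure ((fun t => a * t + w)%R @^-1` A) = lebesgue_measure A)%E.
Proof.
move=> a0 mA.
have [m' m'E] := pushforward_measure_exists (@lebesgue_measure R) (measurable_affine1 a w).
rewrite -m'E; symmetry.
rewrite (@lebesgue_measure_unique R (mscale (NngNum (normr_ge0 a)) m')) // => X [[x y] _ <-] /=.
rewrite /mscale /= m'E preimage_affine_itv//.
case: ifPn => a1.
  rewrite lebesgue_measure_itv [X in (_ * X)%E]lebesgue_measure_itv /= !lte_fin.
  rewrite ltr_pM2r ?invr_gt0// ltrD2r.
  case: ifPn => xy; last by rewrite mule0.
  rewrite -!EFinD -EFinM gtr0_norm//; congr EFin; field; exact: a0.
have a2 : a < 0 by case: (ltgtP a 0) a0 a1.
rewrite lebesgue_measure_itv [X in (_ * X)%E]lebesgue_measure_itv /= !lte_fin ltr_nM2r ?invr_lt0// ltrD2r.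
case: ifPn => xy; last by rewrite mule0.
rewrite -!EFinD -EFinM ltr0_norm//; congr EFin; field; exact: a0.
Qed.

Lemma lebesgue2_preimage_homothety (a : R) (w : R * R) (A : set R2) : a != 0 -> measurable A ->
  ((a ^+ 2)%:E * mu ((fun x : R * R => a *: x + w)%R @^-1` A) = mu A)%E.
Proof.
move=> a0 mA.
pose h (x : R2) : R2 := (a * x.1 + w.1, a * x.2 + w.2).
have mh : measurable_fun setT h.
  apply: measurable_fun_pair.
    exact: (measurableT_comp (measurable_affine1 a w.1) measurable_fst).
  exact: (measurableT_comp (measurable_affine1 a w.2) measurable_snd).
have [m' m'E] := pushforward_measure_exists mu mh.
have -> : (fun x : R * R => a *: x + w) @^-1` A = h @^-1` A by [].
rewrite -m'E; symmetry.
apply: (@product_measure_unique _ _ _ _ R lebesgue_measure lebesgue_measure (mscale (NngNum (sqr_ge0 a)) m') _ A mA) => X Y mX mY /=.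
rewrite /mscale /= m'E.
have -> : h @^-1` (X `*` Y) = ((fun t => a * t + w.1) @^-1` X) `*` ((fun t => a * t + w.2) @^-1` Y) by [].
rewrite /lebesgue2 /= product_measure1E; last 2 first.
- by rewrite -[X in measurable X]setTI; exact: measurable_affine1.
- by rewrite -[X in measurable X]setTI; exact: measurable_affine1.
rewrite -(lebesgue_preimage_affine w.1 a0 mX) -(lebesgue_preimage_affine w.2 a0 mY).
rewrite muleACA -EFinM -normrM -expr2 ger0_norm ?sqr_ge0//.
Qed.

End Measure.

(** * Second order Taylor estimates *)

Section Taylor.
Variable R : realType.

Lemma is_derive_fst (f : R * R -> R) (x y : R) : derivable f (x, y) ((1, 0) : R * R) ->
  is_derive x 1 (fun s => f (s, y)) ('D_((1, 0) : R * R) f (x, y)).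
Proof.
have E : (fun h : R => h^-1 *: (((fun s => f (s, y)) \o shift x) (h *: 1) - f (x, y))) =
         (fun h : R => h^-1 *: ((f \o shift (x, y)) (h *: (1, 0)) - f (x, y))).
  by apply/funext => h /=; congr (_ *: (f _ - _)); apply: pair_ext; rewrite /shift /= ?scaler0 ?add0r.
by move=> df; apply: DeriveDef; rewrite /derivable /derive /= E.
Qed.

Lemma is_derive_snd (f : R * R -> R) (x y : R) : derivable f (x, y) ((0, 1) : R * R) ->
  is_derive y 1 (fun s => f (x, s)) ('D_((0, 1) : R * R) f (x, y)).
Proof.
have E : (fun h : R => h^-1 *: (((fun s => f (x, s)) \o shift y) (h *: 1) - f (x, y))) =
         (fun h : R => h^-1 *: ((f \o shift (x, y)) (h *: (0, 1)) - f (x, y))).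
  by apply/funext => h /=; congr (_ *: (f _ - _)); apply: pair_ext; rewrite /shift /= ?scaler0 ?add0r.
by move=> df; apply: DeriveDef; rewrite /derivable /derive /= E.
Qed.

(** The endpoints will be coordinates of two arbitrary points, so their order is left open. *)
Lemma MVT_between (g dg : R -> R) (a b : R) :
  (forall t, Num.min a b <= t <= Num.max a b -> is_derive t 1 g (dg t)) ->
  exists2 c, Num.min a b <= c <= Num.max a b & g b - g a = dg c * (b - a).
Proof.
wlog ab : a b / a <= b.
  move=> W; have [ab H|] := boolP (a <= b); first exact: W.
  rewrite -ltNge => ab H.
  have [||c cab E] := W b a; first exact: ltW.
    by move=> t; rewrite minC maxC => /H.
  by exists c; rewrite 1?minC 1?maxC //; lra.
rewrite min_l// max_r// => H.
have [||c] := @MVT_segment R g dg a b ab.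
- by move=> x; rewrite in_itv /= => /andP[ax xb]; apply: H; rewrite !ltW.
- apply: derivable_within_continuous => x; rewrite in_itv /= => xab.
  by have [] := H _ xab.
- by rewrite in_itv /= => cab E; exists c.
Qed.

Lemma MVT_between_le (g dg : R -> R) (a b B : R) :
  (forall t, Num.min a b <= t <= Num.max a b -> is_derive t 1 g (dg t) /\ `|dg t| <= B) ->
  `|g b - g a| <= B * `|b - a|.
Proof.
move=> H; have [|c /H[_ cB] ->] := @MVT_between g dg a b; first by move=> t /H[].
by rewrite normrM ler_wpM2r.
Qed.

Lemma between_ball (a b c z e : R) : Num.min a b <= c <= Num.max a b ->
  `|z - a| < e -> `|z - b| < e -> `|z - c| < e.
Proof. by case: (leP a b) => ab; rewrite !ltr_norml; lra. Qed.

Lemma between_dist (a b c : R) : Num.min a b <= c <= Num.max a b ->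
  `|c - a| <= `|b - a|.
Proof. by case: (leP a b) => ab hc; case: (ger0P (c - a)) => h1; case: (ger0P (b - a)) => h2; lra. Qed.

(** First order expansion with a uniform quadratic remainder. G1 and G2 are kept abstract, so that
    chaining expansions involves no differentiability. *)
Definition taylor_on (L : R) (f G1 G2 : R * R -> R) (V : set (R * R)) := forall p q, V p -> V q ->
  `|f q - f p - (G1 p * (q.1 - p.1) + G2 p * (q.2 - p.2))| <= L * `|q - p| ^+ 2.

(** Go from p to q parallel to the axes through (q.1, p.2), which stays in the ball because balls of
    the max norm are squares. The three units in 3 * B come from one increment each of f_y along y,
    f_y along x and f_x along x. *)
Lemma ball_taylor (f : R * R -> R) (B : R) (z : R * R) (e : R) :
  let fx := partial 1 0 f in let fy := partial 0 1 f in
  (forall d1 d2, (d1 + d2 <= 1)%N -> forall x, ball z e x ->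
         derivable (partial d1 d2 f) x (1, 0) /\
         derivable (partial d1 d2 f) x (0, 1)) ->
  (forall d1 d2, (d1 + d2 <= 2)%N -> forall x, ball z e x -> `|partial d1 d2 f x| <= B) ->
  taylor_on (3 * B) f fx fy (ball z e).
Proof.
move=> fx fy dF bF [p1 p2] [q1 q2] /ball_prodP [/= hp1 hp2] /ball_prodP [/= hq1 hq2].
have D00 := dF 0%N 0%N isT; have D10 := dF 1%N 0%N isT; have D01 := dF 0%N 1%N isT.
have [|eta he E1] := @MVT_between (fun s => f (q1, s)) (fun s => fy (q1, s)) p2 q2.
  move=> t ht; apply: is_derive_snd; apply: (D00 (q1, t) _).2.
  by apply/ball_prodP; split=> //=; exact: between_ball ht _ _.
have [|xi hx E2] := @MVT_between (fun s => f (s, p2)) (fun s => fx (s, p2)) p1 q1.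
  move=> t ht; apply: is_derive_fst; apply: (D00 (t, p2) _).1.
  by apply/ball_prodP; split=> //=; exact: between_ball ht _ _.
have F1 : `|fy (q1, eta) - fy (q1, p2)| <= B * `|eta - p2|.
  apply: (@MVT_between_le (fun s => fy (q1, s)) (fun s => partial 0 2 f (q1, s))) => t ht.
  have ht' : ball z e (q1, t).
    apply/ball_prodP; split=> //=; apply: (between_ball ht) => //; exact: between_ball he _ _.
  by split; [apply: is_derive_snd; apply: (D01 _ ht').2|exact: bF].
have F2 : `|fy (q1, p2) - fy (p1, p2)| <= B * `|q1 - p1|.
  apply: (@MVT_between_le (fun s => fy (s, p2)) (fun s => partial 1 1 f (s, p2))) => t ht.
  have ht' : ball z e (t, p2).
    by apply/ball_prodP; split=> //=; apply: (between_ball ht).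
  by split; [apply: is_derive_fst; apply: (D01 _ ht').1|exact: bF].
have F3 : `|fx (xi, p2) - fx (p1, p2)| <= B * `|xi - p1|.
  apply: (@MVT_between_le (fun s => fx (s, p2)) (fun s => partial 2 0 f (s, p2))) => t ht.
  have ht' : ball z e (t, p2).
    apply/ball_prodP; split=> //=; apply: (between_ball ht) => //; exact: between_ball hx _ _.
  by split; [apply: is_derive_fst; apply: (D10 _ ht').1|exact: bF].
have B0 : 0 <= B by apply: le_trans (bF 0%N 0%N isT (p1, p2) _) => //; apply/ball_prodP.
set n := `|(q1, q2) - (p1, p2)|.
have n1 : `|q1 - p1| <= n by exact: (norm_fst ((q1, q2) - (p1, p2))).
have n2 : `|q2 - p2| <= n by exact: (norm_snd ((q1, q2) - (p1, p2))).
have n0 : 0 <= n by exact: normr_ge0.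
have -> : f (q1, q2) - f (p1, p2) - (fx (p1, p2) * ((q1, q2).1 - (p1, p2).1) + fy (p1, p2) * ((q1, q2).2 - (p1, p2).2))
  = (fy (q1, eta) - fy (q1, p2)) * (q2 - p2) + (fy (q1, p2) - fy (p1, p2)) * (q2 - p2)
    + (fx (xi, p2) - fx (p1, p2)) * (q1 - p1).
  rewrite /= in E1 E2 *; have -> : f (q1, q2) = f (p1, p2) + fx (xi, p2) * (q1 - p1) + fy (q1, eta) * (q2 - p2) by lra.
  ring.
have -> : 3 * B * n ^+ 2 = B * n * n + B * n * n + B * n * n by ring.
have step (u v m : R) : `|u| <= B * m -> m <= n -> `|v| <= n -> `|u * v| <= B * n * n.
  move=> hu hm hv; rewrite normrM; apply: ler_pM => //.
  by apply: le_trans hu _; exact: ler_wpM2l.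
apply: le_trans (ler_normD _ _) _; apply: lerD.
  apply: le_trans (ler_normD _ _) _; apply: lerD.
    by apply: (step _ _ _ F1 _ n2); exact: le_trans (between_dist he) n2.
  exact: (step _ _ _ F2 n1 n2).
by apply: (step _ _ _ F3 _ n1); exact: le_trans (between_dist hx) n1.
Qed.

(* Comparing the expansions at p and q avoids the second derivative D_y (D_x f), which partial does
   not provide: partial 1 1 f is D_x (D_y f). *)
Lemma taylor_gradient_lipschitz (L : R) f G1 G2 V (p q : R * R) : 0 <= L -> taylor_on L f G1 G2 V ->
  V p -> V q -> V (q + (`|q - p|, 0)) -> V (q + (0, `|q - p|)) ->
  `|G1 q - G1 p| <= 6 * L * `|q - p| /\ `|G2 q - G2 p| <= 6 * L * `|q - p|.
Proof.
move=> L0 tay Vp Vq V1 V2; set d := `|q - p|.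
have [d0|d0] := eqVneq d 0.
  have /eqP : q - p == 0 by rewrite -normr_eq0 -/d d0.
  by move/eqP; rewrite subr_eq0 => /eqP ->; rewrite !subrr normr0 d0 mulr0.
have dp : 0 < d by rewrite lt_neqAle eq_sym d0 normr_ge0.
(* The expansions from p to q, from p to q + w and from q to q + w are combined; their remainders
   are at most 1, 4 and 1 times L d^2. *)
have key w : `|w| <= d -> V (q + w) ->
    `|(G1 q - G1 p) * w.1 + (G2 q - G2 p) * w.2| <= 6 * L * d ^+ 2.
  move=> wd Vw.
  have := tay q (q + w) Vq Vw; have := tay p (q + w) Vp Vw; have := tay p q Vp Vq.
  have -> : q + w - q = w by rewrite addrC addKr.
  have -> : q + w - p = w + (q - p) by rewrite addrAC addrC.
  rewrite -/d.
  have h1 : `|w + (q - p)| <= 2 * d by apply: le_trans (ler_normD _ _) _; rewrite -/d; lra.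
  have h2 : L * `|w| ^+ 2 <= L * d ^+ 2 by apply: ler_wpM2l => //; apply: lerXn2r; rewrite ?nnegrE// ltW.
  have h3 : L * `|w + (q - p)| ^+ 2 <= 4 * (L * d ^+ 2).
    have -> : 4 * (L * d ^+ 2) = L * (2 * d) ^+ 2 by ring.
    by apply: ler_wpM2l => //; apply: lerXn2r; rewrite ?nnegrE// mulr_ge0// ltW.
  rewrite !pairE.
  have -> : 6 * L * d ^+ 2 = 4 * (L * d ^+ 2) + L * d ^+ 2 + L * d ^+ 2 by ring.
  move=> t1 /le_trans /(_ h3) t2 /le_trans /(_ h2) t3.
  move: t1 t2 t3; rewrite !ler_norml; lra.
have n1 : `|(d, 0) : R * R| <= d by rewrite prod_norm_le /= normr0 ger0_norm ?lexx// ltW.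
have n2 : `|(0, d) : R * R| <= d by rewrite prod_norm_le /= normr0 ger0_norm ?lexx ltW.
have := key _ n1 V1; have := key _ n2 V2; rewrite /= !mulr0 add0r addr0 !normrM !(gtr0_norm dp).
by rewrite expr2 mulrA !ler_pM2r.
Qed.

(** Expansions are available only on balls of an uncontrolled radius e along the segment. Chaining
    them over n short steps gives constants that do not depend on e: gradient increments add up to 6
    L d, and 13 = 1 + 6 + 6 counts the local remainder and the drift of the two gradient
    components. *)
Lemma segment_taylor (L : R) f G1 G2 (p q : R * R) (e : R) : 0 <= L -> 0 < e ->
  (forall t : R, 0 <= t <= 1 -> taylor_on L f G1 G2 (ball ((1 - t) *: p + t *: q) e)) ->
  [/\ `|G1 q - G1 p| <= 6 * L * `|q - p|, `|G2 q - G2 p| <= 6 * L * `|q - p| &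
   `|f q - f p - (G1 p * (q.1 - p.1) + G2 p * (q.2 - p.2))| <= 13 * L * `|q - p| ^+ 2].
Proof.
move=> L0 e0 tay; set d := `|q - p|.
have d0 : 0 <= d by exact: normr_ge0.
(* The factor 2 leaves room for the auxiliary points of [taylor_gradient_lipschitz], which lie up to
   two steps away from P i. *)
pose n := (Num.truncn (2 * d / e)).+1.
have n0 : 0 < n%:R :> R by rewrite ltr0n.
have hn : 2 * (d / n%:R) < e.
  rewrite mulrA ltr_pdivrMr// [e * _]mulrC -ltr_pdivrMr//; exact: truncnS_gt.
pose h := n%:R^-1 *: (q - p).
have nh : `|h| = d / n%:R by rewrite normrZ ger0_norm ?invr_ge0 ?ltW// mulrC.
pose P (i : nat) := p + i%:R *: h.
have PS i : P i.+1 - P i = h.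
  by rewrite /P -natr1 scalerDl scale1r; apply: pair_ext; rewrite !pairE; ring.
have P0 : P 0%N = p by rewrite /P scale0r addr0.
have Pn : P n = q by rewrite /P /h scalerA mulfV ?gt_eqF// scale1r addrC subrK.
have loc i : (i < n)%N -> taylor_on L f G1 G2 (ball (P i) e).
  move=> hi; have ht : 0 <= (i%:R / n%:R : R) <= 1.
    by rewrite divr_ge0//= ler_pdivrMr// mul1r ler_nat ltnW.
  have := tay _ ht.
  have -> : (1 - i%:R / n%:R) *: p + (i%:R / n%:R) *: q = P i.
    by rewrite /P /h; apply: pair_ext; rewrite !pairE; ring.
  by [].
have inb i w : `|w| < e -> ball (P i) e (P i + w).
  by move=> we; rewrite -ball_normE /= opprD addrA subrr add0r normrN.
have st i : (i < n)%N ->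
  [/\ `|G1 (P i.+1) - G1 (P i)| <= 6 * L * (d / n%:R), `|G2 (P i.+1) - G2 (P i)| <= 6 * L * (d / n%:R) &
   `|f (P i.+1) - f (P i) - (G1 (P i) * h.1 + G2 (P i) * h.2)| <= L * (d / n%:R) ^+ 2].
  move=> hi; have EP : P i.+1 = P i + h by rewrite -(PS i) addrC subrK.
  have dn0 : 0 <= d / n%:R by rewrite divr_ge0// ltW.
  have V0 : ball (P i) e (P i) by exact: ballxx.
  have V1 : ball (P i) e (P i.+1) by rewrite EP; apply: inb; rewrite nh; lra.
  have [||] := @taylor_gradient_lipschitz L f G1 G2 _ (P i) (P i.+1) L0 (loc i hi) V0 V1.
  - rewrite PS EP -addrA; apply: inb; apply: le_lt_trans (ler_normD _ _) _.
    have : `|(`|h|, 0) : R * R| <= `|h| by rewrite prod_norm_le /= normr0 normr_id lexx /=.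
    rewrite nh; lra.
  - rewrite PS EP -addrA; apply: inb; apply: le_lt_trans (ler_normD _ _) _.
    have : `|(0, `|h|) : R * R| <= `|h| by rewrite prod_norm_le /= normr0 normr_id lexx /= normr_ge0.
    rewrite nh; lra.
  - rewrite PS nh => a1 a2; split => //.
    by have := loc i hi _ _ V0 V1; rewrite PS nh -fstN -fstD -sndN -sndD PS.
have lip i : (i <= n)%N ->
  `|G1 (P i) - G1 p| <= 6 * L * (i%:R / n%:R * d) /\ `|G2 (P i) - G2 p| <= 6 * L * (i%:R / n%:R * d).
  elim: i => [_|i IH hi]; first by rewrite P0 !subrr normr0 !mul0r mulr0.
  have [I1 I2] := IH (ltnW hi); have [s1 s2 _] := st i hi.
  have -> : 6 * L * (i.+1%:R / n%:R * d) = 6 * L * (d / n%:R) + 6 * L * (i%:R / n%:R * d).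
    by rewrite -natr1; ring.
  split; [have -> : G1 (P i.+1) - G1 p = (G1 (P i.+1) - G1 (P i)) + (G1 (P i) - G1 p) by ring
         |have -> : G2 (P i.+1) - G2 p = (G2 (P i.+1) - G2 (P i)) + (G2 (P i) - G2 p) by ring];
    by apply: le_trans (ler_normD _ _) _; exact: lerD.
have h1 : `|h.1| <= d / n%:R by rewrite -nh norm_fst.
have h2 : `|h.2| <= d / n%:R by rewrite -nh norm_snd.
have tl i : (i <= n)%N ->
  `|f (P i) - f p - i%:R * (G1 p * h.1 + G2 p * h.2)| <= i%:R * (13 * L * d * (d / n%:R)).
  elim: i => [_|i IH hi]; first by rewrite P0 subrr !mul0r subr0 normr0.
  have [_ _ s3] := st i hi; have [l1 l2] := lip i (ltnW hi).
  have -> : f (P i.+1) - f p - i.+1%:R * (G1 p * h.1 + G2 p * h.2) =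
    (f (P i) - f p - i%:R * (G1 p * h.1 + G2 p * h.2)) +
    ((f (P i.+1) - f (P i) - (G1 (P i) * h.1 + G2 (P i) * h.2)) +
     ((G1 (P i) - G1 p) * h.1 + (G2 (P i) - G2 p) * h.2)).
    by rewrite -natr1; ring.
  apply: le_trans (ler_normD _ _) _.
  rewrite -(natr1 i) [leRHS]mulrDl; apply: lerD; first exact: IH (ltnW hi).
  have i1 : i%:R / n%:R * d <= d.
    rewrite -[leRHS]mul1r; apply: ler_wpM2r => //.
    by rewrite ler_pdivrMr// mul1r ler_nat ltnW.
  have b1 : 6 * L * (i%:R / n%:R * d) <= 6 * L * d by apply: ler_wpM2l => //; rewrite mulr_ge0.
  have -> : 1 * (13 * L * d * (d / n%:R)) = L * d * (d / n%:R) + (6 * L * d * (d / n%:R) + 6 * L * d * (d / n%:R)) by ring.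
  have dn0 : 0 <= d / n%:R by rewrite divr_ge0// ltW.
  apply: le_trans (ler_normD _ _) _; apply: lerD.
    apply: le_trans s3 _; have -> : L * (d / n%:R) ^+ 2 = L * (d / n%:R) * (d / n%:R) by ring.
    apply: ler_wpM2r => //; apply: ler_wpM2l => //.
    by rewrite ler_pdivrMr// ler_peMr// ler1n.
  apply: le_trans (ler_normD _ _) _; apply: lerD; rewrite normrM.
    exact: ler_pM (le_trans l1 b1) h1.
  exact: ler_pM (le_trans l2 b1) h2.
have nn0 : n%:R != 0 :> R by rewrite gt_eqF.
have [lip1 lip2] := lip n (leqnn n); have tln := tl n (leqnn n).
have E1 : 6 * L * (n%:R / n%:R * d) = 6 * L * d by rewrite mulfV// mul1r.
have E2 : n%:R * (13 * L * d * (d / n%:R)) = 13 * L * d ^+ 2 by field.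
have E3 : n%:R * (G1 p * h.1 + G2 p * h.2) = G1 p * (q.1 - p.1) + G2 p * (q.2 - p.2).
  by rewrite /h !pairE; field.
by move: lip1 lip2 tln; rewrite Pn E1 E2 E3 => *; split.
Qed.

End Taylor.

(** * Pointwise consequences of the C^2 norm *)

Section C2.
Variable R : realType.
Local Notation mu := (lebesgue2 R).

Lemma C2_norm_ge0 (D : set (R * R)) f : (0 <= C2_norm D f)%E.
Proof. by rewrite /C2_norm; elim/big_ind : _ => [//|x y x0 y0|i _]; [rewrite le_max x0|exact: Lnorm_ge0]. Qed.

Lemma C2_norm_bound_ge0 (D : set (R * R)) f (B : R) : (C2_norm D f <= B%:E)%E -> 0 <= B.
Proof. by move=> nB; rewrite -lee_fin; apply: le_trans nB; exact: C2_norm_ge0. Qed.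

(** From an essential bound to a pointwise one: the derivative agrees with a continuous function in
    the open interior, so exceeding B at a point would mean exceeding it on a ball, which has
    positive measure. *)
Lemma C2_norm_partial (D : set (R * R)) f (B : R) : C2_on D f -> (C2_norm D f <= B%:E)%E ->
  forall d1 d2, (d1 + d2 <= 2)%N -> forall x, D° x -> `|partial d1 d2 f x| <= B.
Proof.
move=> [_ _ ext] nB d1 d2 hd x Dx.
have i1 : (d1 < 3)%N by lia.
have i2 : (d2 < 3)%N by lia.
have : ('N[mu]_+oo[EFin \o (partial d1 d2 f \_ D°)] <= B%:E)%E.
  apply: le_trans nB; rewrite /C2_norm.
  exact: (@le_bigmax_cond _ _ _ _ (Ordinal i1, Ordinal i2) (fun d : 'I_3 * 'I_3 => (d.1 + d.2 <= 2)%N)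
    (fun d => 'N[mu]_+oo[EFin \o (partial d.1 d.2 f \_ D°)]%E)).
(* The norm of exponent +oo unfolds to an essential supremum only when the whole space has positive
   measure. *)
have mu0 : (0 < mu setT)%E.
  apply: (@lt_le_trans _ _ (mu (ball (0 : R * R) 1))); first by rewrite lebesgue2_ball// lte_fin.
  by apply: le_measure; rewrite ?inE//; exact: measurable_ball2.
rewrite unlock mu0 => esB; rewrite leNgt; apply/negP => Bx.
have [h hc hE] := ext d1 d2 hd.
have oD : open D° by exact: open_interior.
have hx : {for x, continuous h}.
  have : {within D°, continuous h} by apply: continuous_subspaceW hc; exact: interior_subset.
  by rewrite continuous_open_subspace//; apply; rewrite inE.
have [A [mA A0 sA]] := ess_sup_ge mu (abse \o (EFin \o (partial d1 d2 f \_ D°))).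
have : nbhs x [set y | D° y /\ B < `|h y|].
  apply: filterI; first exact: open_nbhs_nbhs.
  have : (Num.norm \o h) y @[y --> x] --> `|h x| by apply: cvg_norm.
  by move=> /(_ [set t | B < t]); apply; apply: open_nbhs_nbhs; split; [exact: open_gt|rewrite /= -hE].
move=> /nbhs_ballP[e /= e0 He].
have : (mu (ball x e) <= mu A)%E.
  apply: le_measure; rewrite ?inE//; first exact: measurable_ball2.
  move=> y /He[Dy hy]; apply: sA => /=; rewrite patchE mem_set// hE//.
  by move=> /le_trans /(_ esB); rewrite lee_fin leNgt hy.
by apply/negP; rewrite -ltNge A0 lebesgue2_ball ?ltW// lte_fin exprn_gt0// mulrn_wgt0.
Qed.

Lemma bary_lipschitz (T : triangle R) : exists2 K : R, 0 < K & forall p q,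
  [/\ `|baryA T p - baryA T q| <= K * `|p - q|, `|baryB T p - baryB T q| <= K * `|p - q| &
      `|baryC T p - baryC T q| <= K * `|p - q|].
Proof.
pose a1 := ((vC T).2 - (vA T).2) / triangle_det T; pose a2 := ((vC T).1 - (vA T).1) / triangle_det T.
pose b1 := ((vB T).1 - (vA T).1) / triangle_det T; pose b2 := ((vB T).2 - (vA T).2) / triangle_det T.
pose K := `|a1| + `|a2| + `|b1| + `|b2| + 1.
have K0 : 0 < K by rewrite /K ltr_wpDl// !addr_ge0.
exists K => // p q.
have n1 : `|p.1 - q.1| <= `|p - q| by exact: (norm_fst (p - q)).
have n2 : `|p.2 - q.2| <= `|p - q| by exact: (norm_snd (p - q)).
have M (a u : R) : `|u| <= `|p - q| -> `|a * u| <= `|a| * `|p - q| by move=> h; rewrite normrM ler_wpM2l.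
have key (c d : R) : `|c| + `|d| <= K -> `|c * (p.1 - q.1) + d * (p.2 - q.2)| <= K * `|p - q|.
  move=> h; apply: le_trans (ler_normD _ _) _; apply: le_trans (lerD (M _ _ n1) (M _ _ n2)) _.
  by rewrite -mulrDl; apply: ler_wpM2r.
have [h1 h2 h3 h4] : [/\ 0 <= `|a1|, 0 <= `|a2|, 0 <= `|b1| & 0 <= `|b2|] by [].
split.
- have -> : baryA T p - baryA T q = (b2 - a1) * (p.1 - q.1) + (a2 - b1) * (p.2 - q.2).
    by rewrite /baryA /baryB /baryC -/a1 -/a2 -/b1 -/b2; ring.
  apply: key; apply: le_trans (lerD (ler_normB _ _) (ler_normB _ _)) _; rewrite /K; lra.
- have -> : baryB T p - baryB T q = a1 * (p.1 - q.1) + (- a2) * (p.2 - q.2).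
    by rewrite /baryB -/a1 -/a2; ring.
  apply: key; rewrite normrN /K; lra.
- have -> : baryC T p - baryC T q = (- b2) * (p.1 - q.1) + b1 * (p.2 - q.2).
    by rewrite /baryC -/b1 -/b2; ring.
  apply: key; rewrite normrN /K; lra.
Qed.

(** The least coordinate c of p and q is a lower bound along the whole segment by convexity, and
    coordinates are K-Lipschitz, so radius c / K works. *)
Lemma core_segment_margin (T : triangle R) p q : triangle_core T p -> triangle_core T q ->
  exists2 e : R, 0 < e & forall t, 0 <= t <= 1 -> ball ((1 - t) *: p + t *: q) e `<=` triangle_core T.
Proof.
move=> [pA pB pC] [qA qB qC]; have [K K0 HK] := bary_lipschitz T.
pose c := Num.min (Num.min (Num.min (baryA T p) (baryB T p)) (baryC T p))
                  (Num.min (Num.min (baryA T q) (baryB T q)) (baryC T q)).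
have c0 : 0 < c by rewrite /c !lt_min pA pB pC qA qB qC.
have : [/\ c <= baryA T p, c <= baryB T p & c <= baryC T p] /\ [/\ c <= baryA T q, c <= baryB T q & c <= baryC T q].
  by rewrite /c; split; split; rewrite !ge_min lexx ?orbT.
move: (c) c0 => {}c c0 [[cpA cpB cpC] [cqA cqB cqC]].
exists (c / K); first exact: divr_gt0.
move=> t /andP[t0 t1] x; set z := (_ + _); rewrite -ball_normE /= => zx.
have [EA EB EC] := bary_convex T t p q; rewrite -/z in EA EB EC.
have [LA LB LC] := HK z x.
have lt : K * `|z - x| < c by rewrite mulrC -ltr_pdivlMr.
have cv (a b : R) : c <= a -> c <= b -> c <= (1 - t) * a + t * b.
  move=> ca cb; have -> : c = (1 - t) * c + t * c by ring.
  by apply: lerD; apply: ler_wpM2l => //; lra.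
split.
- have := cv _ _ cpA cqA; rewrite -EA; move: LA; rewrite ler_norml; lra.
- have := cv _ _ cpB cqB; rewrite -EB; move: LB; rewrite ler_norml; lra.
- have := cv _ _ cpC cqC; rewrite -EC; move: LC; rewrite ler_norml; lra.
Qed.

(** Here L = 3 * B from [ball_taylor] enters [segment_taylor], whence 18 = 6 * 3 and 39 = 13 * 3. *)
Lemma C2_taylor (T : triangle R) f (B : R) : nondegenerate T ->
  C2_on (triangle_set T) f -> (C2_norm (triangle_set T) f <= B%:E)%E ->
  let G1 := partial 1 0 f in let G2 := partial 0 1 f in
  forall p q, triangle_core T p -> triangle_core T q ->
  [/\ `|G1 p| <= B /\ `|G2 p| <= B,
      `|G1 q - G1 p| <= 18 * B * `|q - p|, `|G2 q - G2 p| <= 18 * B * `|q - p| &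
      `|f q - f p - (G1 p * (q.1 - p.1) + G2 p * (q.2 - p.2))| <= 39 * B * `|q - p| ^+ 2].
Proof.
move=> hT hf nB G1 G2 p q Up Uq.
have sub := triangle_core_interior hT.
have bnd := C2_norm_partial hf nB.
have B0 : 0 <= B by apply: le_trans (bnd 0%N 0%N isT p (sub _ Up)).
have [e e0 He] := core_segment_margin Up Uq.
have L0 : 0 <= 3 * B by rewrite mulr_ge0.
have [|h1 h2 h3] := @segment_taylor R (3 * B) f G1 G2 p q e L0 e0.
- move=> t /He bt; apply: ball_taylor => [d1 d2 hd x /bt /sub Dx|d1 d2 hd x /bt /sub Dx]; last exact: bnd.
  by case: hf => _ dF _; exact: dF.
have -> : 18 * B = 6 * (3 * B) by ring.
have -> : 39 * B = 13 * (3 * B) by ring.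
by split => //; split; apply: bnd => //; exact: sub.
Qed.

(** The point x may lie on the boundary. The constant is left implicit: it serves only to show that
    centroid sums converge to the mean integral. *)
Lemma C2_lipschitz (T : triangle R) f (B : R) : nondegenerate T ->
  C2_on (triangle_set T) f -> (C2_norm (triangle_set T) f <= B%:E)%E ->
  exists2 L : R, 0 <= L & forall x c, triangle_set T x -> triangle_core T c -> `|f x - f c| <= L * `|x - c|.
Proof.
move=> hT hf nB.
have tay := C2_taylor hT hf nB.
pose D := `|vA T| + `|vB T| + `|vC T|.
have nD x : triangle_set T x -> `|x| <= D.
  move=> [a [b [c [a0 b0 c0 S ->]]]]; rewrite /D.
  have le1 (s : R) (v : R * R) : 0 <= s -> s <= 1 -> `|s *: v| <= `|v|.
    by move=> s0 s1; rewrite normrZ ger0_norm// ler_piMl.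
  apply: le_trans (ler_normD _ _) _; apply: lerD; last by apply: le1; lra.
  apply: le_trans (ler_normD _ _) _; apply: lerD; apply: le1; lra.
have D0 : 0 <= D by rewrite /D !addr_ge0.
have B0 := C2_norm_bound_ge0 nB.
have L0 : 0 <= 2 * B + 39 * B * (2 * D) by rewrite addr_ge0// !mulr_ge0.
exists (2 * B + 39 * B * (2 * D)) => // x c Tx Uc.
set L := (_ + _) in L0 *.
have lipU y : triangle_core T y -> `|f y - f c| <= L * `|y - c|.
  move=> Uy; have [[g1 g2] _ _ h] := tay c y Uc Uy.
  have n1 : `|y.1 - c.1| <= `|y - c| by exact: (norm_fst (y - c)).
  have n2 : `|y.2 - c.2| <= `|y - c| by exact: (norm_snd (y - c)).
  have e1 : `|partial 1 0 f c * (y.1 - c.1)| <= B * `|y - c| by rewrite normrM; exact: ler_pM.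
  have e2 : `|partial 0 1 f c * (y.2 - c.2)| <= B * `|y - c| by rewrite normrM; exact: ler_pM.
  have d2 : `|y - c| <= 2 * D.
    apply: le_trans (ler_normB _ _) _; have := nD _ (triangle_core_sub hT Uy).
    have := nD _ (triangle_core_sub hT Uc); lra.
  have e3 : 39 * B * `|y - c| ^+ 2 <= 39 * B * (2 * D) * `|y - c|.
    by rewrite -[leRHS]mulrA expr2; apply: ler_wpM2l; [rewrite mulr_ge0|apply: ler_wpM2r].
  rewrite /L mulrDl.
  have -> : f y - f c = (f y - f c - (partial 1 0 f c * (y.1 - c.1) + partial 0 1 f c * (y.2 - c.2))) +
    (partial 1 0 f c * (y.1 - c.1) + partial 0 1 f c * (y.2 - c.2)) by rewrite subrK.
  apply: le_trans (ler_normD _ _) _; rewrite addrC; apply: lerD; last exact: le_trans e3.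
  by apply: le_trans (ler_normD _ _) _; rewrite -mulrA mulrDl !mul1r; apply: lerD.
(* To reach the boundary, x is replaced by a point y slightly closer to c: y lies in the core, f y
   is close to f x by continuity, and y is no farther from c than x. *)
apply/ler_addgt0Pr => eta eta0.
have fc := hf; case: fc => /subspace_continuousP /(_ x Tx) fx _ _.
have : \forall y \near within (triangle_set T) (nbhs x), `|f x - f y| < eta.
  have /cvgrPdist_lt := fx; exact.
rewrite near_withinE => /nbhs_ballP[e /= e0 He].
pose t := Num.min 1 (e / (2 * (`|x - c| + 1))).
have n0 : 0 < `|x - c| + 1 by rewrite ltr_wpDl.
have t0 : 0 < t by rewrite lt_min ltr01 divr_gt0// mulr_gt0.
have t1 : t <= 1 by rewrite ge_min lexx.
pose y := (1 - t) *: x + t *: c.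
have Uy : triangle_core T y.
  have [EA EB EC] := bary_convex T t x c; case: Uc => cA cB cC.
  have /triangle_setP - /(_ hT) [xA xB xC] := Tx.
  split; rewrite ?EA ?EB ?EC; apply: ltr_wpDl; try exact: mulr_gt0; apply: mulr_ge0 => //; lra.
have xy : `|x - y| < e.
  have -> : x - y = t *: (x - c) by apply: pair_ext; rewrite /y !pairE; ring.
  rewrite normrZ gtr0_norm//.
  have : t * (2 * (`|x - c| + 1)) <= e by rewrite -ler_pdivlMr ?mulr_gt0// ge_min lexx orbT.
  have : 0 <= t * `|x - c| by rewrite mulr_ge0// ltW.
  lra.
have := He y; rewrite -ball_normE /= => /(_ xy (triangle_core_sub hT Uy)) h1.
have h2 := lipU y Uy.
have h3 : `|y - c| <= `|x - c|.
  have -> : y - c = (1 - t) *: (x - c) by apply: pair_ext; rewrite /y !pairE; ring.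
  by rewrite normrZ ger0_norm ?subr_ge0// ler_piMl//; lra.
have h4 : L * `|y - c| <= L * `|x - c| by exact: ler_wpM2l.
have -> : f x - f c = (f x - f y) + (f y - f c) by ring.
by apply: le_trans (ler_normD _ _) _; lra.
Qed.

End C2.

(** * The composite centroid rule *)

Lemma big_row2 (V : nmodType) (F : row2 -> V) :
  \sum_(xi : 'F_2 * 'F_2) F xi = F (0, 0) + F (1, 0) + F (0, 1) + F (1, 1).
Proof.
rewrite (bigD1 (0, 0))//= (bigD1 (1, 0))//= (bigD1 (0, 1))//= (bigD1 (1, 1))//= big1 ?addr0 ?addrA//.
by elim/row2_ind.
Qed.

Section ChildMean.
Variable R : realType.
Implicit Types (T Y Z : triangle R) (F H : triangle R -> R).

(** An averaging operator on functions of triangles; its n-th iterate on [f \o center] is the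
    composite centroid rule with 4^n cells. *)
Definition child_mean F Y : R := 4^-1 * \sum_(xi : 'F_2 * 'F_2) F (subtriangle Y xi).

Fixpoint descendant n Y Z : Prop :=
  if n is n'.+1 then exists xi, descendant n' (subtriangle Y xi) Z else Z = Y.

Lemma descendantSr n Y Z : descendant n.+1 Y Z -> exists2 Z', descendant n Y Z' & exists xi, Z = subtriangle Z' xi.
Proof.
elim: n Y => [Y [xi ->]|n IH Y [xi /IH[Z' h1 h2]]]; first by exists Y => //; exists xi.
by exists Z' => //; exists xi.
Qed.

Lemma descendant_iter n T Z : descendant n T Z -> exists X, Z = subtriangle_iter T X n.
Proof.
elim: n Z => [Z ->|n IH Z /descendantSr[Z' /IH[X ->] [xi ->]]]; first by exists (fun=> (0, 0)).
exists (fun i => if i == n then xi else X i); rewrite /= eqxx; congr subtriangle.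
by apply: eq_subtriangle_iter => i ni; rewrite (ltn_eqF ni).
Qed.

Lemma eq_child_mean F H Y : F =1 H -> child_mean F Y = child_mean H Y.
Proof. by move=> E; rewrite /child_mean; under eq_bigr do rewrite E. Qed.

Lemma iter_child_meanD n F H T :
  iter n child_mean (fun Y => F Y + H Y) T = iter n child_mean F T + iter n child_mean H T.
Proof.
elim: n T => //= n IH T; rewrite (eq_child_mean _ IH) /child_mean -mulrDr; congr (_ * _).
by rewrite big_split.
Qed.

Lemma iter_child_meanN n F T :
  iter n child_mean (fun Y => - F Y) T = - iter n child_mean F T.
Proof.
elim: n T => //= n IH T; rewrite (eq_child_mean _ IH) /child_mean -mulrN; congr (_ * _).
by rewrite sumrN.
Qed.

Lemma iter_child_mean_cst n c T : iter n child_mean (fun=> c) T = c.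
Proof.
by elim: n T => //= n IH T; rewrite (eq_child_mean _ IH) /child_mean big_row2; field.
Qed.

Lemma iter_child_mean_bound n F T c :
  (forall Y, descendant n T Y -> `|F Y| <= c) -> `|iter n child_mean F T| <= c.
Proof.
elim: n T => [T /(_ T erefl)//|n IH T H].
have b xi : `|iter n child_mean F (subtriangle T xi)| <= c by apply: IH => Y hY; apply: H; exists xi.
rewrite iterS /child_mean normrM ger0_norm ?invr_ge0// big_row2 ler_pdivrMl//.
have -> : 4 * c = c + c + c + c by ring.
by do 3 (apply: le_trans (ler_normD _ _) _; apply: lerD => //).
Qed.

Definition spread T : R := `|vA T - center T| + `|vB T - center T| + `|vC T - center T|.

Lemma spread_ge0 T : 0 <= spread T. Proof. by rewrite !addr_ge0. Qed.

Lemma prefix_sign_norm X r : `|prefix_sign R X r| = 1.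
Proof.
rewrite /prefix_sign normr_prod big1// => i _.
by rewrite /row_sign; case: ifP => _; rewrite ?normrN normr1.
Qed.

Lemma row_shift_norm T xi : `|row_shift T xi| <= spread T.
Proof.
have [h1 h2 h3] : [/\ 0 <= `|vA T - center T|, 0 <= `|vB T - center T| & 0 <= `|vC T - center T|] by [].
by rewrite /row_shift /spread; elim/row2_ind : xi; rewrite /= ?normr0; lra.
Qed.

Lemma phi_dist T X r : `|phi T r.+1 X - phi T r X| <= spread T / 2 ^+ r.+1.
Proof.
rewrite phiS addrC addKr normrZ normrM prefix_sign_norm mul1r ger0_norm ?invr_ge0 ?exprn_ge0//.
by rewrite mulrC ler_wpM2r ?invr_ge0 ?exprn_ge0// row_shift_norm.
Qed.

Lemma descendant_diameter n T Y x : descendant n T Y -> triangle_set Y x ->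
  `|x - center Y| <= spread T / 2 ^+ n.
Proof.
move=> /descendant_iter[X ->] [a [b [c [a0 b0 c0 S ->]]]].
have [-> -> ->] := subtriangle_iter_homothetic T X n.
set g := center (subtriangle_iter _ _ _); set k := _ / _.
have -> : a *: (g + k *: (vA T - center T)) + b *: (g + k *: (vB T - center T)) +
   c *: (g + k *: (vC T - center T)) - g =
   k *: (a *: (vA T - center T) + b *: (vB T - center T) + c *: (vC T - center T)).
  have -> : c = 1 - a - b by lra.
  by apply: pair_ext; rewrite !pairE; ring.
have le1 (s : R) (v : R * R) : 0 <= s -> s <= 1 -> `|s *: v| <= `|v|.
  by move=> s0 s1; rewrite normrZ ger0_norm// ler_piMl.
rewrite normrZ normrM prefix_sign_norm mul1r ger0_norm ?invr_ge0 ?exprn_ge0// mulrC.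
apply: ler_wpM2r; first by rewrite invr_ge0 exprn_ge0.
rewrite /spread; apply: le_trans (ler_normD _ _) _; apply: lerD; last by apply: le1; lra.
apply: le_trans (ler_normD _ _) _; apply: lerD; apply: le1; lra.
Qed.

(** A barycentric coordinate of T is nonnegative at the three vertices with a positive sum. This
    passes to children, whose vertices are vertices or midpoints, and makes the value at the
    centroid positive. Positivity at each vertex would fail, since vertices may stay on the
    boundary. *)
Lemma phi_core T X n : nondegenerate T -> triangle_core T (phi T n X).
Proof.
move=> hT.
pose P (g : R * R -> R) Y := [/\ 0 <= g (vA Y), 0 <= g (vB Y), 0 <= g (vC Y) & 0 < g (vA Y) + g (vB Y) + g (vC Y)].
have step (g : R * R -> R) Y xi : (forall p q, g (midpoint p q) = (g p + g q) / 2) ->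
    P g Y -> P g (subtriangle Y xi).
  case: Y => A B C gm [/= gA gB gC S].
  by elim/row2_ind: xi; rewrite /P /= !gm; split; lra.
have it (g : R * R -> R) : (forall p q, g (midpoint p q) = (g p + g q) / 2) ->
    P g T -> P g (subtriangle_iter T X n).
  by move=> gm gT; elim: n => //= m IH; exact: step.
have ct (g : R * R -> R) Y : (forall x y z : R * R, g (3^-1 *: (x + y + z)) = (g x + g y + g z) / 3) ->
   P g Y -> 0 < g (center Y).
  by move=> gc [_ _ _ S]; rewrite /center gc; lra.
have one : 1 + 0 + 0 = 1 :> R by ring.
have two : 0 + 1 + 0 = 1 :> R by ring.
have thr : 0 + 0 + 1 = 1 :> R by ring.
have [vA1 vA2 vA3] := bary_comb hT one; have [vB1 vB2 vB3] := bary_comb hT two.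
have [vC1 vC2 vC3] := bary_comb hT thr.
rewrite !scale0r !scale1r !addr0 ?add0r in vA1 vA2 vA3 vB1 vB2 vB3 vC1 vC2 vC3.
split; apply: ct; try apply: it.
- by move=> x y z; rewrite /baryA /baryB /baryC !pairE; field; exact: hT.
- by move=> x y; rewrite /baryA /baryB /baryC /midpoint !pairE; field; exact: hT.
- by rewrite /P vA1 vB1 vC1; split; lra.
- by move=> x y z; rewrite /baryB !pairE; field; exact: hT.
- by move=> x y; rewrite /baryB /midpoint !pairE; field; exact: hT.
- by rewrite /P vA2 vB2 vC2; split; lra.
- by move=> x y z; rewrite /baryC !pairE; field; exact: hT.
- by move=> x y; rewrite /baryC /midpoint !pairE; field; exact: hT.
- by rewrite /P vA3 vB3 vC3; split; lra.
Qed.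

End ChildMean.

(** * The mean integral and the centroid rule *)

Section CentroidRule.
Variable R : realType.
Local Notation mu := (lebesgue2 R).
Local Notation R2 := (measurableTypeR R * measurableTypeR R)%type.
Implicit Types (T Y Z : triangle R).

Lemma subtriangle_measure Y xi (v : R) : measurable (triangle_set Y : set R2) ->
  mu (triangle_set Y) = v%:E ->
  measurable (triangle_set (subtriangle Y xi) : set R2) /\ mu (triangle_set (subtriangle Y xi)) = (4^-1 * v)%:E.
Proof.
move=> mY vY; have [a [w [a4 E]]] := subtriangle_preimage Y xi.
have a0 : a != 0.
  by apply/eqP => a0; move: a4; rewrite a0 expr0n /= => /eqP; rewrite eq_sym pnatr_eq0.
have mZ : measurable (triangle_set (subtriangle Y xi) : set R2).
  rewrite E -[X in measurable X]setTI.
  have mh : measurable_fun setT (fun x : R2 => (a * x.1 + w.1, a * x.2 + w.2) : R2).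
    apply: measurable_fun_pair.
      exact: (measurableT_comp (measurable_affine1 a w.1) measurable_fst).
    exact: (measurableT_comp (measurable_affine1 a w.2) measurable_snd).
  exact: mh.
split=> //; have := lebesgue2_preimage_homothety w a0 mY.
rewrite -E vY a4; set m := mu _ => h.
have : (4^-1%:E * (4%:E * m))%E = (4^-1 * v)%:E by rewrite h -EFinM.
by rewrite muleA -EFinM mulVf// mul1e.
Qed.

Lemma subtriangle_sub Y xi : triangle_set (subtriangle Y xi) `<=` triangle_set Y.
Proof.
case: Y => A B C; elim/row2_ind: xi => x [a [b [c [a0 b0 c0 S ->]]]].
- exists ((b + c) / 2), ((a + c) / 2), ((a + b) / 2); split; [lra|lra|lra|lra|].
  by apply: pair_ext; rewrite ?pairE /= /midpoint ?pairE; field.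
- exists (a + b / 2 + c / 2), (b / 2), (c / 2); split; [lra|lra|lra|lra|].
  by apply: pair_ext; rewrite ?pairE /= /midpoint ?pairE; field.
- exists (a / 2), (a / 2 + b + c / 2), (c / 2); split; [lra|lra|lra|lra|].
  by apply: pair_ext; rewrite ?pairE /= /midpoint ?pairE; field.
- exists (a / 2), (b / 2), (a / 2 + b / 2 + c); split; [lra|lra|lra|lra|].
  by apply: pair_ext; rewrite ?pairE /= /midpoint ?pairE; field.
Qed.

(* Only subadditivity over the four children is used: the resulting upper bound, applied to f and to
   - f, makes it unnecessary to show that the children overlap in null sets. *)
Lemma integral_subtriangles Y (g : R * R -> R) :
  measurable (triangle_set Y : set R2) -> (forall xi, measurable (triangle_set (subtriangle Y xi) : set R2)) ->
  measurable_fun (triangle_set Y : set R2) (g : R2 -> measurableTypeR R) ->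
  (forall x, triangle_set Y x -> 0 <= g x) ->
  (\int[mu]_(x in triangle_set Y) (g x)%:E <=
   \sum_(xi : 'F_2 * 'F_2) \int[mu]_(x in triangle_set (subtriangle Y xi)) (g x)%:E)%E.
Proof.
move=> mY mS mg g0.
have mR (S : set R2) : measurable S -> S `<=` triangle_set Y ->
    measurable_fun setT ((fun x : R2 => (g x)%:E) \_ S).
  move=> mS' sS; apply/(measurable_restrictT _ mS'); apply/measurable_EFinP.
  exact: measurable_funS mg.
have g0' (S : set R2) : S `<=` triangle_set Y -> forall x, (0 <= ((fun x : R2 => (g x)%:E) \_ S) x)%E.
  by move=> sS x; rewrite patchE; case: ifPn => // /set_mem /sS /g0; rewrite lee_fin.
rewrite integral_mkcond; under eq_bigr do rewrite integral_mkcond.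
rewrite -ge0_integral_sum//; last 2 first.
- by move=> xi; apply: mR => //; exact: subtriangle_sub.
- by move=> xi x _; apply: g0'; exact: subtriangle_sub.
apply: ge0_le_integral => //.
- by move=> x _; exact: g0'.
- exact: mR.
- by apply: emeasurable_sum => xi; apply: mR => //; exact: subtriangle_sub.
move=> x _; have [Yx|Yx] := pselect (triangle_set Y x); last first.
  rewrite [leLHS]patchE memNset//; apply: sume_ge0 => xi _.
  by apply: g0'; exact: subtriangle_sub.
have [xi Sx] := triangle_set_cover Yx.
rewrite (bigD1 xi)//= !patchE !mem_set// leeDl//.
by apply: sume_ge0 => xi' _; apply: g0'; exact: subtriangle_sub.
Qed.

(** Each subdivision divides the measure by 4, matching the weight in [child_mean]; at the last
    level the integrand is bounded by a constant on each cell. *)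
Lemma integral_le_child_mean n Y (g : R * R -> R) (v e : R) :
  measurable (triangle_set Y : set R2) -> mu (triangle_set Y) = v%:E ->
  measurable_fun (triangle_set Y : set R2) (g : R2 -> measurableTypeR R) ->
  (forall x, triangle_set Y x -> 0 <= g x) ->
  (forall Z, descendant n Y Z -> forall x, triangle_set Z x -> g x <= g (center Z) + e) ->
  (\int[mu]_(x in triangle_set Y) (g x)%:E <= (v * (iter n (@child_mean R) (g \o @center R) Y + e))%:E)%E.
Proof.
elim: n Y v => [|n IH] Y v mY vY mg g0 H.
  have -> : (v * (iter 0 (@child_mean R) (g \o @center R) Y + e))%:E =
      (\int[mu]_(x in triangle_set Y) (cst (g (center Y) + e)%:E) x)%E.
    by rewrite integral_cst// vY -EFinM mulrC.
  apply: ge0_le_integral => //.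
  - exact/measurable_EFinP.
  - by move=> x Yx; rewrite lee_fin; exact: H.
have sm xi := subtriangle_measure xi mY vY.
apply: le_trans (integral_subtriangles mY (fun xi => (sm xi).1) mg g0) _.
apply: (@le_trans _ _ (\sum_(xi : 'F_2 * 'F_2) (4^-1 * v * (iter n (@child_mean R) (g \o @center R) (subtriangle Y xi) + e))%:E)%E).
  apply: lee_sum => xi _; apply: IH; [exact: (sm xi).1|exact: (sm xi).2| | |].
  - apply: measurable_funS mg => //; exact: subtriangle_sub.
  - by move=> x /subtriangle_sub; exact: g0.
  - by move=> Z hZ; apply: H; exists xi.
by rewrite sumEFin lee_fin iterS {2}/child_mean !big_row2 le_eqVlt; apply/orP; left; apply/eqP; field.
Qed.

(** Positivity comes from a ball around the center inside the core, finiteness from a larger ball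
    containing the triangle. *)
Lemma triangle_measure T : nondegenerate T ->
  [/\ measurable (triangle_set T : set R2), exists2 v : R, 0 < v & mu (triangle_set T) = v%:E &
      exists M : R, forall x, triangle_set T x -> `|x| <= M].
Proof.
move=> hT.
have mT : measurable (triangle_set T : set R2).
  rewrite -[X in measurable X]setCK; apply: measurableC; apply: open_prod_measurable.
  by apply: closed_openC; exact: closed_triangle_set.
have bnd x : triangle_set T x -> `|x - center T| <= spread T.
  by move=> Tx; have := @descendant_diameter R 0 T T x erefl Tx; rewrite expr0 divr1.
have sb : triangle_set T `<=` ball (center T) (spread T + 1).
  move=> x /bnd h; rewrite -ball_normE /= distrC; lra.
split=> //.
  exists (fine (mu (triangle_set T))).
    apply: fine_gt0; apply/andP; split.
      have Uc : triangle_core T (center T) by exact: (@phi_core R T (fun=> (0,0)) 0 hT).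
      have : nbhs (center T) (triangle_core T) by apply: open_nbhs_nbhs; split=> //; exact: open_triangle_core.
      move=> /nbhs_ballP[e /= e0 He].
      apply: (@lt_le_trans _ _ (mu (ball (center T) e))).
        by rewrite lebesgue2_ball ?ltW// lte_fin exprn_gt0// mulrn_wgt0.
      apply: le_measure; rewrite ?inE//; first exact: measurable_ball2.
      by move=> x /He; exact: triangle_core_sub.
    apply: (@le_lt_trans _ _ (mu (ball (center T) (spread T + 1)))).
      by apply: le_measure; rewrite ?inE//; exact: measurable_ball2.
    by rewrite lebesgue2_ball ?ltry// addr_ge0// spread_ge0.
  rewrite fineK// ge0_fin_numE//.
  apply: (@le_lt_trans _ _ (mu (ball (center T) (spread T + 1)))).
    by apply: le_measure; rewrite ?inE//; exact: measurable_ball2.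
  by rewrite lebesgue2_ball ?ltry// addr_ge0// spread_ge0.
exists (spread T + `|center T|) => x /bnd h.
by rewrite -[x](subrK (center T)); apply: le_trans (ler_normD _ _) _; rewrite lerD2r.
Qed.

Lemma lipschitz_integrable T (f : R * R -> R) (L : R) : nondegenerate T -> 0 <= L ->
  {within triangle_set T, continuous f} ->
  (forall x c, triangle_set T x -> triangle_core T c -> `|f x - f c| <= L * `|x - c|) ->
  [/\ measurable_fun (triangle_set T : set R2) (f : R2 -> measurableTypeR R),
      mu.-integrable (triangle_set T) (EFin \o f) &
      exists2 K : R, 0 <= K & forall x, triangle_set T x -> `|f x| <= K].
Proof.
move=> hT L0 fc lip; have [mT [v v0 vE] _] := triangle_measure hT.
have mf : measurable_fun (triangle_set T : set R2) (f : R2 -> measurableTypeR R).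
  exact: within_continuous_measurable.
have Uc : triangle_core T (center T) by exact: (@phi_core R T (fun=> (0,0)) 0 hT).
pose K := `|f (center T)| + L * spread T.
have fK x : triangle_set T x -> `|f x| <= K.
  move=> Tx; have := lip _ _ Tx Uc.
  have := @descendant_diameter R 0 T T x erefl Tx; rewrite expr0 divr1 => h.
  have h2 : L * `|x - center T| <= L * spread T by exact: ler_wpM2l.
  have := ler_normD (f (center T)) (f x - f (center T)); rewrite [_ + (_ - _)]addrC subrK /K; lra.
have muoo : (mu (triangle_set T) < +oo)%E by rewrite vE ltry.
split=> //.
  apply: measurable_bounded_integrable => //.
  by exists K; split; [exact: num_real|move=> M KM x Tx; apply: le_trans (fK x Tx) _; exact: ltW].
by exists K => //; rewrite addr_ge0// mulr_ge0// spread_ge0.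
Qed.

Lemma mean_integral_le_child_mean T (f : R * R -> R) (L : R) n : nondegenerate T -> 0 <= L ->
  {within triangle_set T, continuous f} ->
  (forall x c, triangle_set T x -> triangle_core T c -> `|f x - f c| <= L * `|x - c|) ->
  mean_integral T f <= iter n (@child_mean R) (f \o @center R) T + L * spread T / 2 ^+ n.
Proof.
move=> hT L0 fc lip.
have [mT [v v0 vE] _] := triangle_measure hT.
have [mf If [K K0 fK]] := lipschitz_integrable hT L0 fc lip.
(* Adding the bound K makes the integrand nonnegative and shifts both sides of the inequality by
   K. *)
pose g x := f x + K.
have mg : measurable_fun (triangle_set T : set R2) (g : R2 -> measurableTypeR R).
  by apply: measurable_funD mf _; exact: measurable_cst.
have g0 x : triangle_set T x -> 0 <= g x by move=> /fK; rewrite /g ler_norml; lra.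
have muoo : (mu (triangle_set T) < +oo)%E by rewrite vE ltry.
have Ik : mu.-integrable (triangle_set T) (EFin \o (fun=> K)).
  apply: measurable_bounded_integrable => //; exists K; split; [exact: num_real|move=> M KM x Tx].
  by rewrite /= ger0_norm// ltW.
have := @integral_le_child_mean n T g v (L * spread T / 2 ^+ n) mT vE mg g0 _.
have -> : (\int[mu]_(x in triangle_set T) (g x)%:E)%E = (v * (mean_integral T f + K))%:E.
  have -> : v * (mean_integral T f + K) = \int[mu]_(x in triangle_set T) g x.
    rewrite /mean_integral vE /= /g RintegralD// Rintegral_cst// vE /=.
    by field; rewrite gt_eqF.
  rewrite /Rintegral fineK//; have : mu.-integrable (triangle_set T) (EFin \o g).
    by apply: eq_integrable (integrableD mT If Ik).
  exact: integrable_fin_num.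
have -> : iter n (@child_mean R) (g \o @center R) T = iter n (@child_mean R) (f \o @center R) T + K.
  by rewrite -(iter_child_mean_cst n K T) -iter_child_meanD.
rewrite lee_fin ler_pM2l// addrAC lerD2r; apply => Z dZ x Zx.
have [X EZ] := descendant_iter dZ.
have UZ : triangle_core T (center Z) by rewrite EZ; exact: phi_core.
have Tx : triangle_set T x.
  elim: n T dZ {mT vE fc lip hT mf K K0 fK g mg g0 muoo If Ik EZ UZ} => [T <-//|n IH T [xi /IH]].
  exact: subtriangle_sub.
have h2 : L * `|x - center Z| <= L * (spread T / 2 ^+ n).
  by apply: ler_wpM2l => //; exact: descendant_diameter dZ Zx.
rewrite /g addrAC lerD2r -mulrA; have := lip _ _ Tx UZ; rewrite ler_norml; lra.
Qed.

Lemma mean_integral_child_mean T (f : R * R -> R) (L : R) n : nondegenerate T -> 0 <= L ->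
  {within triangle_set T, continuous f} ->
  (forall x c, triangle_set T x -> triangle_core T c -> `|f x - f c| <= L * `|x - c|) ->
  `|iter n (@child_mean R) (f \o @center R) T - mean_integral T f| <= L * spread T / 2 ^+ n.
Proof.
move=> hT L0 fc lip.
have h1 := mean_integral_le_child_mean n hT L0 fc lip.
have fcN : {within triangle_set T, continuous (fun x => - f x)}.
  by move=> x; apply: cvgN; exact: fc.
have lipN x c : triangle_set T x -> triangle_core T c -> `|- f x - - f c| <= L * `|x - c|.
  by move=> Tx Uc; rewrite -opprD normrN; exact: lip.
have := mean_integral_le_child_mean n hT L0 fcN lipN.
have -> : mean_integral T (fun x => - f x) = - mean_integral T f.
  rewrite /mean_integral -mulrN; congr (_ * _).
  have [mf If _] := lipschitz_integrable hT L0 fc lip.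
  have [mT _ _] := triangle_measure hT.
  by rewrite -mulN1r -RintegralZl//; apply: eq_Rintegral => x _; rewrite mulN1r.
rewrite (iter_child_meanN n (f \o @center R)) ler_norml; lra.
Qed.

(** One refinement from level m costs c / 4^m, because linear terms cancel over the four children;
    the geometric series gives 4/3 * c, that is 13 * B * spread^2. The limit is identified with the
    mean integral by the first order estimate. *)
Lemma centroid_rule T (f : R * R -> R) (B : R) n : nondegenerate T ->
  C2_on (triangle_set T) f -> (C2_norm (triangle_set T) f <= B%:E)%E ->
  `|iter n (@child_mean R) (f \o @center R) T - mean_integral T f| <= 13 * B * spread T ^+ 2 / 4 ^+ n.
Proof.
move=> hT hf nB; set F := f \o @center R; set A := @child_mean R.
have [L L0 lip] := C2_lipschitz hT hf nB.
have B0 := C2_norm_bound_ge0 nB.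
have fc : {within triangle_set T, continuous f} by case: hf.
have tay := C2_taylor hT hf nB.
set c := 39 / 4 * B * spread T ^+ 2.
have step m Y : descendant m T Y -> `|A F Y + - F Y| <= c / 4 ^+ m.
  move=> /descendant_iter[X EY].
  have UY : triangle_core T (center Y) by rewrite EY; exact: phi_core.
  pose rem xi := f (center (subtriangle Y xi)) - f (center Y) -
     (partial 1 0 f (center Y) * ((center (subtriangle Y xi)).1 - (center Y).1) +
      partial 0 1 f (center Y) * ((center (subtriangle Y xi)).2 - (center Y).2)).
  have hrem xi : `|rem xi| <= c / 4 ^+ m.
    pose X' i := if i == m then xi else X i.
    have EX' : subtriangle Y xi = subtriangle_iter T X' m.+1.
      rewrite /= {2}/X' eqxx EY; congr subtriangle.
      by apply: eq_subtriangle_iter => i im; rewrite /X' (ltn_eqF im).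
    have US : triangle_core T (center (subtriangle Y xi)) by rewrite EX'; exact: phi_core.
    have EY' : center Y = phi T m X'.
      rewrite EY /phi; congr center.
      by apply: eq_subtriangle_iter => i im; rewrite /X' (ltn_eqF im).
    have [_ _ _ h] := tay _ _ UY US.
    apply: le_trans h _.
    have d : `|center (subtriangle Y xi) - center Y| <= spread T / 2 ^+ m.+1.
      by rewrite EX' EY' -/(phi T m.+1 X'); exact: phi_dist.
    have -> : c / 4 ^+ m = 39 * B * (spread T / 2 ^+ m.+1) ^+ 2.
      have E4 : (2 ^+ m.+1) ^+ 2 = 4 * 4 ^+ m :> R.
        by rewrite -exprM mulnC exprM -exprS; congr (_ ^+ _); ring.
      by rewrite /c expr_div_n E4; field; exact: expf_neq0.
    apply: ler_wpM2l; first by rewrite mulr_ge0.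
    by apply: lerXn2r; rewrite ?nnegrE// divr_ge0 ?exprn_ge0// spread_ge0.
  (* The centers of the four children average to the center of the parent, so the gradient terms
     drop out. *)
  have E1 : \sum_(xi : 'F_2 * 'F_2) (center (subtriangle Y xi) - center Y) = 0.
    case: (Y) => P Q S; rewrite big_row2 /center /=; apply: pair_ext.
      by rewrite /midpoint !pairE; field.
    by rewrite /midpoint !pairE; field.
  have [E11 E12] := pair_eqE E1; rewrite big_row2 !pairE in E11 E12.
  have -> : A F Y + - F Y = 4^-1 * (rem (0, 0) + rem (1, 0) + rem (0, 1) + rem (1, 1)).
    pose dx xi := (center (subtriangle Y xi)).1 - (center Y).1.
    pose dy xi := (center (subtriangle Y xi)).2 - (center Y).2.
    have -> : rem (0, 0) + rem (1, 0) + rem (0, 1) + rem (1, 1) =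
      F (subtriangle Y (0, 0)) + F (subtriangle Y (1, 0)) + F (subtriangle Y (0, 1)) + F (subtriangle Y (1, 1)) - 4 * F Y
      - (partial 1 0 f (center Y) * (dx (0, 0) + dx (1, 0) + dx (0, 1) + dx (1, 1)) +
         partial 0 1 f (center Y) * (dy (0, 0) + dy (1, 0) + dy (0, 1) + dy (1, 1))).
      by rewrite /rem -/(dx _) -/(dy _) /F /comp /dx /dy; ring.
    by rewrite E11 E12 !mulr0 addr0 subr0 /A /child_mean big_row2; field.
  rewrite normrM ger0_norm ?invr_ge0// ler_pdivrMl//.
  have -> : 4 * (c / 4 ^+ m) = c / 4 ^+ m + c / 4 ^+ m + c / 4 ^+ m + c / 4 ^+ m by ring.
  by do 3 (apply: le_trans (ler_normD _ _) _; apply: lerD => //).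
have stepn m : `|iter m.+1 A F T - iter m A F T| <= c / 4 ^+ m.
  by rewrite iterSr -iter_child_meanN -iter_child_meanD; apply: iter_child_mean_bound => Y; exact: step.
have tel k : `|iter (n + k) A F T - iter n A F T| <= 4 / 3 * c * (4 ^- n - 4 ^- (n + k)).
  elim: k => [|k IH]; first by rewrite addn0 !subrr normr0 mulr0.
  have -> : iter (n + k.+1) A F T - iter n A F T =
    (iter (n + k.+1) A F T - iter (n + k) A F T) + (iter (n + k) A F T - iter n A F T) by ring.
  apply: le_trans (ler_normD _ _) _; rewrite addnS; apply: le_trans (lerD (stepn _) IH) _.
  by rewrite exprS le_eqVlt; apply/orP; left; apply/eqP; field; rewrite !expf_neq0.
have c0 : 0 <= c by rewrite /c !mulr_ge0// ?exprn_ge0// spread_ge0.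
apply/ler_addgt0Pr => eta eta0.
(* The level n + k is so deep that the Lipschitz error is at most eta, whatever L is. *)
pose k := Num.truncn (L * spread T / eta).
have hk : L * spread T / 2 ^+ (n + k) <= eta.
  rewrite ler_pdivrMr ?exprn_gt0// [eta * _]mulrC -ler_pdivrMr//.
  apply: ltW; apply: lt_le_trans (truncnS_gt _) _.
  have -> : 2 ^+ (n + k) = (2 ^ (n + k))%N%:R :> R by rewrite natrX.
  rewrite ler_nat; apply: leq_ltn_trans (leq_addl n k) _; exact: ltn_expl.
have h1 := mean_integral_child_mean (n + k) hT L0 fc lip.
have -> : iter n A F T - mean_integral T f =
  - (iter (n + k) A F T - iter n A F T) + (iter (n + k) A F T - mean_integral T f) by ring.
apply: le_trans (ler_normD _ _) _; rewrite normrN; apply: lerD; last exact: le_trans hk.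
apply: le_trans (tel k) _.
have -> : 13 * B * spread T ^+ 2 / 4 ^+ n = 4 / 3 * c * 4 ^- n by rewrite /c; field; exact: expf_neq0.
by apply: ler_wpM2l; [rewrite mulr_ge0|rewrite lerBlDr lerDl invr_ge0 exprn_ge0].
Qed.

End CentroidRule.

(** * Walsh analysis of a block of points *)

Section Fourier.
Variables (R : realType) (V : finZmodType).
Implicit Types (F G H : V -> R) (l : V -> 'F_2).

Definition mean F : R := #|V|%:R^-1 * \sum_v F v.

Lemma eq_mean F G : F =1 G -> mean F = mean G.
Proof. by move=> E; rewrite /mean; under eq_bigr do rewrite E. Qed.

Lemma cardV_gt0 : 0 < #|V|%:R :> R.
Proof. by rewrite ltr0n; apply/card_gt0P; exists 0. Qed.

Lemma mean_cst c : mean (fun=> c) = c.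
Proof. by rewrite /mean sumr_const -[c *+ _]mulr_natl mulrA mulVf ?mul1r// gt_eqF// cardV_gt0. Qed.

Lemma meanD F G : mean (fun v => F v + G v) = mean F + mean G.
Proof. by rewrite /mean big_split mulrDr. Qed.

Lemma meanZ c F : mean (fun v => c * F v) = c * mean F.
Proof. by rewrite /mean -mulr_sumr mulrCA. Qed.

Lemma mean_sum (I : Type) (s : seq I) (F : I -> V -> R) :
  mean (fun v => \sum_(i <- s) F i v) = \sum_(i <- s) mean (F i).
Proof. by rewrite /mean exchange_big mulr_sumr. Qed.

Lemma mean_shift F u : mean (fun v => F (v + u)) = mean F.
Proof. by congr (_ * _); rewrite [RHS](reindex_inj (addIr u)). Qed.

Lemma mean_norm_le F c : (forall v, `|F v| <= c) -> `|mean F| <= c.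
Proof.
move=> Fc; rewrite /mean normrM ger0_norm ?invr_ge0// ler_pdivrMl ?cardV_gt0//.
apply: le_trans (ler_norm_sum _ _ _) _.
by rewrite mulr_natl -sumr_const; apply: ler_sum.
Qed.

Lemma mean_directions F (e : row2 -> V) :
  mean F = mean (fun v => 4^-1 * \sum_(u : 'F_2 * 'F_2) F (v + e u)).
Proof.
rewrite meanZ mean_sum; under eq_bigr do rewrite mean_shift.
by rewrite big_row2; field.
Qed.

Definition sgn2 (x : 'F_2) : R := if x == 0 then 1 else -1.

Lemma F2_ind (P : 'F_2 -> Prop) : P 0 -> P 1 -> forall x, P x.
Proof.
move=> h0 h1 [[|[|i]] hi] //=.
- by have -> : Ordinal hi = 0 :> 'F_2 by apply: val_inj.
- by have -> : Ordinal hi = 1 :> 'F_2 by apply: val_inj.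
Qed.

Lemma sgn2D x y : sgn2 (x + y) = sgn2 x * sgn2 y.
Proof. by elim/F2_ind: x; elim/F2_ind: y; rewrite /sgn2 /= ?mulr1 ?mul1r ?mulrNN ?mulr1. Qed.

Lemma sgn2_norm x : `|sgn2 x| = 1.
Proof. by rewrite /sgn2; case: ifP => _; rewrite ?normrN normr1. Qed.

(** The sign is a bent function of two bits: its four Walsh coefficients all have modulus 1/2. Their
    sum gives the factor 2 for an arbitrary affine row, their maximum the factor 1/2 for a free
    row. *)
Lemma row_sign_fourier (xi : row2) :
  row_sign R xi = 2^-1 * (1 - sgn2 xi.1 - sgn2 xi.2 - sgn2 (xi.1 + xi.2)).
Proof. by elim/row2_ind: xi; rewrite /row_sign /sgn2 /=; field. Qed.

Lemma row_fourier (g : row2 -> R) (xi : row2) : g xi =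
  4^-1 * (g (0, 0) + g (1, 0) + g (0, 1) + g (1, 1)) +
  4^-1 * (g (0, 0) - g (1, 0) + g (0, 1) - g (1, 1)) * sgn2 xi.1 +
  4^-1 * (g (0, 0) + g (1, 0) - g (0, 1) - g (1, 1)) * sgn2 xi.2 +
  4^-1 * (g (0, 0) - g (1, 0) - g (0, 1) + g (1, 1)) * sgn2 (xi.1 + xi.2).
Proof. by elim/row2_ind: xi; rewrite /sgn2 /=; field. Qed.

(* In characteristic 2 this says that l - l 0 is additive. *)
Definition affine_form l := forall u v, l (u + v) = l u + l v + l 0.

Lemma F2_addxx (x : 'F_2) : x + x = 0.
Proof. by apply/eqP; elim/F2_ind: x. Qed.

Lemma affine_formD l l' : affine_form l -> affine_form l' -> affine_form (fun v => l v + l' v).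
Proof. by move=> hl hl' u v; rewrite hl hl'; ring. Qed.

Lemma affine_formZ c l : affine_form l -> affine_form (fun v => c * l v).
Proof. by move=> hl u v; rewrite hl; ring. Qed.

Lemma affine_form0 : affine_form (fun=> 0).
Proof. by move=> u v; rewrite !addr0. Qed.

(* Up to sign, the functions v |-> sgn2 (l v) are the characters of V, so c bounds all the Walsh
   coefficients of H. *)
Definition corr_le H (c : R) := forall l, affine_form l -> `|mean (fun v => sgn2 (l v) * H v)| <= c.

Lemma corr_leW H c c' : c <= c' -> corr_le H c -> corr_le H c'.
Proof. by move=> cc h l /h hl; exact: le_trans cc. Qed.

Lemma eq_corr_le H H' c : H =1 H' -> corr_le H c -> corr_le H' c.
Proof. by move=> E h l /h; rewrite (eq_mean (fun v => _ : _ = sgn2 (l v) * H' v))// => v; rewrite E. Qed.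

Lemma corr_le_mean H c : corr_le H c -> `|mean H| <= c.
Proof.
move/(_ _ affine_form0); rewrite (@eq_mean _ H)// => v.
by rewrite /sgn2 eqxx mul1r.
Qed.

Lemma corr_le_sgn2 H c l : affine_form l -> corr_le H c -> corr_le (fun v => sgn2 (l v) * H v) c.
Proof.
move=> al h l' al'; have := h _ (affine_formD al' al).
by rewrite (@eq_mean _ (fun v => sgn2 (l' v) * (sgn2 (l v) * H v)))// => v; rewrite sgn2D mulrA.
Qed.

Lemma corr_leD H H' c c' : corr_le H c -> corr_le H' c' -> corr_le (fun v => H v + H' v) (c + c').
Proof.
move=> h h' l al; rewrite (@eq_mean _ (fun v => sgn2 (l v) * H v + sgn2 (l v) * H' v)); last first.
  by move=> v; rewrite mulrDr.
by rewrite meanD; apply: le_trans (ler_normD _ _) _; apply: lerD; [exact: h|exact: h'].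
Qed.

Lemma corr_leZ H c a : corr_le H c -> corr_le (fun v => a * H v) (`|a| * c).
Proof.
move=> h l al; rewrite (@eq_mean _ (fun v => a * (sgn2 (l v) * H v))); last first.
  by move=> v; rewrite mulrCA.
by rewrite meanZ normrM; apply: ler_wpM2l => //; exact: h.
Qed.

Lemma corr_le_bound H c : (forall v, `|H v| <= c) -> corr_le H c.
Proof. by move=> Hc l _; apply: mean_norm_le => v; rewrite normrM sgn2_norm mul1r. Qed.

Definition affine_row (x : V -> row2) := affine_form (fun v => (x v).1) /\ affine_form (fun v => (x v).2).

(** Multiplication by a character permutes the characters up to sign, so each of the four Walsh
    terms contributes c / 2. *)
Lemma corr_le_row_sign x H c : affine_row x -> corr_le H c -> corr_le (fun v => row_sign R (x v) * H v) (2 * c).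
Proof.
move=> [a1 a2] h; have a12 := affine_formD a1 a2.
have h1 := corr_leZ (-1) (corr_le_sgn2 a1 h); have h2 := corr_leZ (-1) (corr_le_sgn2 a2 h).
have h12 := corr_leZ (-1) (corr_le_sgn2 a12 h).
have := corr_leZ 2^-1 (corr_leD (corr_leD (corr_leD h h1) h2) h12).
rewrite normrN1 ger0_norm ?invr_ge0// => H4.
apply: (@eq_corr_le _ _ (2 * c) _ (corr_leW _ H4)); last by lra.
by move=> v; rewrite row_sign_fourier; ring.
Qed.

(** Expanding g in the four characters of a row, each coefficient is at most S; this gives 4 * S. *)
Lemma corr_le_row_fun x H c (g : row2 -> R) S : affine_row x -> (forall xi, `|g xi| <= S) ->
  corr_le H c -> corr_le (fun v => g (x v) * H v) (4 * S * c).
Proof.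
move=> [a1 a2] gS h; have a12 := affine_formD a1 a2.
have c0 : 0 <= c by apply: le_trans (corr_le_mean h).
pose k0 := 4^-1 * (g (0, 0) + g (1, 0) + g (0, 1) + g (1, 1)).
pose k1 := 4^-1 * (g (0, 0) - g (1, 0) + g (0, 1) - g (1, 1)).
pose k2 := 4^-1 * (g (0, 0) + g (1, 0) - g (0, 1) - g (1, 1)).
pose k3 := 4^-1 * (g (0, 0) - g (1, 0) - g (0, 1) + g (1, 1)).
have bd (a b d e : R) : `|a| <= S -> `|b| <= S -> `|d| <= S -> `|e| <= S -> `|4^-1 * (a + b + d + e)| <= S.
  rewrite normrM ger0_norm ?invr_ge0// ler_pdivrMl//= => ha hb hd he.
  have -> : 4 * S = S + S + S + S by ring.
  by do 3 (apply: le_trans (ler_normD _ _) _; apply: lerD => //).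
have hk0 : `|k0| <= S by apply: bd.
have hk1 : `|k1| <= S by apply: bd; rewrite ?normrN.
have hk2 : `|k2| <= S by apply: bd; rewrite ?normrN.
have hk3 : `|k3| <= S by apply: bd; rewrite ?normrN.
have h1 := corr_leZ k1 (corr_le_sgn2 a1 h); have h2 := corr_leZ k2 (corr_le_sgn2 a2 h).
have h3 := corr_leZ k3 (corr_le_sgn2 a12 h).
have H4 := corr_leD (corr_leD (corr_leD (corr_leZ k0 h) h1) h2) h3.
apply: (@eq_corr_le _ _ _ _ (corr_leW _ H4)).
  by move=> v; rewrite [g (x v)]row_fourier -/k0 -/k1 -/k2 -/k3; ring.
have -> : 4 * S * c = S * c + S * c + S * c + S * c by ring.
by do 3 (apply: lerD; last exact: ler_wpM2r); exact: ler_wpM2r.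
Qed.

(* Averaging over the four translates by e replaces row_sign by a character times one of its Walsh
   coefficients, which all equal 1/2 in absolute value. *)
Lemma corr_le_free_row x H c (e : row2 -> V) : affine_row x ->
  (forall u, e u = (if u.1 == 0 then 0 else e (1, 0)) + (if u.2 == 0 then 0 else e (0, 1))) ->
  (forall v u, x (v + e u) = x v + u) -> (forall v u, H (v + e u) = H v) ->
  corr_le H c -> corr_le (fun v => row_sign R (x v) * H v) (2^-1 * c).
Proof.
move=> [a1 a2] eE xe He h l al.
pose al1 := l (e (1, 0)) + l 0; pose al2 := l (e (0, 1)) + l 0.
have le v u : l (v + e u) = l v + (al1 * u.1 + al2 * u.2).
  rewrite eE; elim/row2_ind: u => /=; rewrite ?addr0 ?add0r ?mulr0 ?mulr1 ?addr0 ?add0r //.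
  - by rewrite al /al1; ring.
  - by rewrite al /al2; ring.
  - rewrite addrA !al /al1 /al2; ring.
rewrite (mean_directions _ e).
have -> : mean (fun v => 4^-1 * \sum_(u : 'F_2 * 'F_2) (sgn2 (l (v + e u)) * (row_sign R (x (v + e u)) * H (v + e u)))) =
  mean (fun v => 4^-1 * (\sum_(u : 'F_2 * 'F_2) sgn2 (al1 * u.1 + al2 * u.2) * row_sign R u) *
    (sgn2 (l v + (al1 * (x v).1 + al2 * (x v).2)) * H v)).
  apply: eq_mean => v; rewrite -mulrA; congr (_ * _); rewrite mulr_suml.
  (* Translating u by x v turns the argument of the sign into u itself. What depends on v is then a
     character times H, and the sum over u is a Walsh coefficient of the sign. *)
  rewrite (reindex_inj (addrI (x v))) /=; apply: eq_bigr => u _.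
  rewrite le xe He; have -> : x v + (x v + u) = u.
    by rewrite addrA; apply: injective_projections; rewrite /= F2_addxx add0r.
  have -> : l v + (al1 * (x v + u).1 + al2 * (x v + u).2) =
      (al1 * u.1 + al2 * u.2) + (l v + (al1 * (x v).1 + al2 * (x v).2)) by rewrite /=; ring.
  by rewrite (sgn2D (al1 * u.1 + al2 * u.2)) mulrACA.
rewrite meanZ normrM; apply: ler_pM => //; last first.
  by apply: h; apply: affine_formD => //; apply: affine_formD; apply: affine_formZ.
rewrite big_row2; move: al1 al2 {le} => b1 b2.
elim/F2_ind: b1; elim/F2_ind: b2; rewrite /sgn2 /row_sign /=; rewrite ler_norml; lra.
Qed.

(** * The error on one block *)

Section Block.
Variables (X : V -> nat -> row2) (d : nat).

(* The second condition, a dual basis for the first d rows, forces these rows to be jointly uniformly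
   distributed as v ranges over V. *)
Definition affine_block := (forall i, affine_row (fun v => X v i)) /\
  forall i, (i < d)%N -> exists2 e : row2 -> V,
    (forall u, e u = (if u.1 == 0 then 0 else e (1, 0)) + (if u.2 == 0 then 0 else e (0, 1))) &
    forall k v u, (k < d)%N -> X (v + e u) k = if k == i then X v k + u else X v k.

Hypothesis HX : affine_block.

(** Moving along the directions attached to row k changes that row through all four values and fixes
    the rows before it, so averaging over them performs one [child_mean]. *)
Lemma mean_subtriangle_iter (T : triangle R) (F : triangle R -> R) k : (k <= d)%N ->
  mean (fun v => F (subtriangle_iter T (X v) k)) = iter k (@child_mean R) F T.
Proof.
elim: k F => [|k IH] F kd; first by rewrite /= mean_cst.
have [e _ He] := HX.2 _ kd.
rewrite (mean_directions _ e) iterSr -(IH _ (ltnW kd)); apply: eq_mean => v.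
rewrite /child_mean (reindex_inj (addrI (X v k))) /=; congr (_ * _); apply: eq_bigr => u _.
rewrite He// eqxx; have -> : X v k + (X v k + u) = u.
  by rewrite addrA; apply: injective_projections; rewrite /= F2_addxx add0r.
congr (F (subtriangle _ _)); apply: eq_subtriangle_iter => i ik.
by rewrite He ?(ltn_eqF ik)// (ltn_trans ik).
Qed.

Lemma corr_le_row_signs j n (H : V -> R) c : (j <= n)%N -> corr_le H c ->
  corr_le (fun v => (\prod_(j <= i < n) row_sign R (X v i)) * H v) (2 ^+ (n - j) * c).
Proof.
elim: n => [|n IH]; rewrite leq_eqVlt => /orP[/eqP jE|jn] h.
- by rewrite jE subnn expr0 mul1r; apply: eq_corr_le h => v; rewrite big_geq// mul1r.
- by [].
- by rewrite jE subnn expr0 mul1r; apply: eq_corr_le h => v; rewrite big_geq// mul1r.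
have := corr_le_row_sign (HX.1 n) (IH jn h).
rewrite subSn// exprS -mulrA; apply: eq_corr_le => v.
by rewrite big_nat_recr//= mulrA [row_sign _ _ * _]mulrC.
Qed.

(** Signs are peeled off from the last one: the directions attached to row n fix all rows of smaller
    index, hence the earlier signs and G, and each step gains 1/2. *)
Lemma corr_le_free_row_signs j n (G : (nat -> row2) -> R) c : (j <= n)%N -> (n <= d)%N ->
  (forall Y Y', (forall i, (i < j)%N -> Y i = Y' i) -> G Y = G Y') -> (forall v, `|G (X v)| <= c) ->
  corr_le (fun v => (\prod_(j <= i < n) row_sign R (X v i)) * G (X v)) (c / 2 ^+ (n - j)).
Proof.
move=> + + Gj Gc; have h0 := corr_le_bound Gc.
elim: n => [|n IH]; rewrite leq_eqVlt => /orP[/eqP jE|jn] nd.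
- by rewrite jE expr0 divr1; apply: eq_corr_le h0 => v; rewrite big_geq// mul1r.
- by [].
- by rewrite jE subnn expr0 divr1; apply: eq_corr_le h0 => v; rewrite big_geq// mul1r.
have [e e1 He] := HX.2 _ nd.
have inv v u : \prod_(j <= i < n) row_sign R (X (v + e u) i) * G (X (v + e u)) =
     \prod_(j <= i < n) row_sign R (X v i) * G (X v).
  congr (_ * _).
    rewrite !big_nat; apply: eq_bigr => i /andP[_ ni].
    by rewrite He ?(ltn_eqF ni)// (ltn_trans ni).
  by apply: Gj => i ij; rewrite He ?(ltn_eqF (leq_trans ij jn))// (ltn_trans (leq_trans ij jn)).
have xe v u : X (v + e u) n = X v n + u by rewrite He// eqxx.
have := corr_le_free_row (HX.1 n) e1 xe inv (IH jn (ltnW nd)).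
rewrite subSn// exprS invfM mulrCA; apply: eq_corr_le => v.
by rewrite big_nat_recr//= mulrA [row_sign _ _ * _]mulrC.
Qed.

Variables (T : triangle R) (f : R * R -> R) (B : R).
Hypotheses (hT : nondegenerate T) (hf : C2_on (triangle_set T) f)
  (nB : (C2_norm (triangle_set T) f <= B%:E)%E).

Lemma eq_phi Y Y' n : (forall i, (i < n)%N -> Y i = Y' i) -> phi T n Y = phi T n Y'.
Proof. by move=> E; rewrite /phi (eq_subtriangle_iter T E). Qed.

Lemma phi_dist_add Y n k : `|phi T (n + k) Y - phi T n Y| <= spread T / 2 ^+ n.
Proof.
have S0 := spread_ge0 T.
suff : `|phi T (n + k) Y - phi T n Y| <= spread T * (2 ^- n - 2 ^- (n + k)).
  move=> h; apply: le_trans h _; apply: ler_wpM2l => //.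
  by rewrite lerBlDr lerDl invr_ge0 exprn_ge0.
elim: k => [|k IH]; first by rewrite addn0 !subrr normr0 mulr0.
rewrite addnS -(subrK (phi T (n + k) Y) (phi T (n + k).+1 Y)) -addrA.
apply: le_trans (ler_normD _ _) _; apply: le_trans (lerD (phi_dist _ _ _) IH) _.
by rewrite exprS le_eqVlt; apply/orP; left; apply/eqP; field; rewrite !expf_neq0.
Qed.

(* The gradient at the r-th center is split along the centers of levels 0, ..., d and r: the
   increment between levels j and j + 1 only depends on the rows of index <= j, so averaging over the
   rows of index between j + 1 and d gains a factor 1/2 for each of them. *)
Lemma mean_signed_gradient (G : R * R -> R) (g : row2 -> R) S r : (d <= r)%N ->
  (forall p, triangle_core T p -> `|G p| <= B) ->
  (forall p q, triangle_core T p -> triangle_core T q -> `|G q - G p| <= 18 * B * `|q - p|) ->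
  (forall xi, `|g xi| <= S) ->
  `|mean (fun v => g (X v r) * (prefix_sign R (X v) r * G (phi T r (X v))))| <=
  4 * S * 2 ^+ (r - d) * (B / 2 ^+ d + d%:R * (18 * B * spread T / 2 ^+ d)) + S * (18 * B * spread T / 2 ^+ d).
Proof.
move=> dr GB Glip gS.
have S0 : 0 <= S by apply: le_trans (gS (0, 0)).
have B0 := C2_norm_bound_ge0 nB.
pose D j Y := G (phi T j.+1 Y) - G (phi T j Y).
have split v : g (X v r) * (prefix_sign R (X v) r * G (phi T r (X v))) =
  g (X v r) * (prefix_sign R (X v) r * G (phi T 0 (X v))) +
  \sum_(j < d) g (X v r) * (prefix_sign R (X v) r * D j (X v)) +
  g (X v r) * (prefix_sign R (X v) r * (G (phi T r (X v)) - G (phi T d (X v)))).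
  rewrite -!mulr_sumr.
  have -> : \sum_(j < d) D j (X v) = G (phi T d (X v)) - G (phi T 0 (X v)).
    by rewrite -(big_mkord predT (fun j => D j (X v))) telescope_sumr.
  by ring.
rewrite (eq_mean split) !meanD mean_sum.
(* The sign product is cut at j and d. Rows before j are absorbed into K without changing its
   modulus, free rows from j to d gain 1/2 each, rows from d to r cost 2 each, and row r enters
   through g. *)
have main j (K : (nat -> row2) -> R) c : (j <= d)%N ->
    (forall Y Y', (forall i, (i < j)%N -> Y i = Y' i) -> K Y = K Y') -> (forall Y, `|K Y| <= c) ->
    `|mean (fun v => g (X v r) * (prefix_sign R (X v) r * K (X v)))| <= 4 * S * 2 ^+ (r - d) * (c / 2 ^+ (d - j)).
  move=> jd Kj Kc.
  pose K' Y := prefix_sign R Y j * K Y.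
  have K'j Y Y' : (forall i, (i < j)%N -> Y i = Y' i) -> K' Y = K' Y'.
    move=> E; rewrite /K' (Kj _ _ E); congr (_ * _).
    by apply: eq_bigr => i _; rewrite E.
  have K'c v : `|K' (X v)| <= c by rewrite normrM prefix_sign_norm mul1r.
  have h1 := corr_le_free_row_signs jd (leqnn d) K'j K'c.
  have h2 := corr_le_row_fun (HX.1 r) gS (corr_le_row_signs dr h1).
  apply: le_trans (corr_le_mean (eq_corr_le _ h2)) _; last by rewrite !mulrA.
  move=> v; congr (_ * _); rewrite /K' !mulrA; congr (_ * _).
  rewrite /prefix_sign -!(big_mkord predT (fun i => row_sign R (X v i))).
  rewrite (big_cat_nat (leq0n d) dr) (big_cat_nat (leq0n j) jd) /=.
  by rewrite [LHS]mulrC [X in _ * X = _]mulrC mulrA.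
have b0 : `|mean (fun v => g (X v r) * (prefix_sign R (X v) r * G (phi T 0 (X v))))| <= 4 * S * 2 ^+ (r - d) * (B / 2 ^+ d).
  have := main 0%N (fun Y => G (phi T 0 Y)) B; rewrite subn0; apply => // Y.
  by apply: GB; exact: phi_core.
have b1 (j : 'I_d) : `|mean (fun v => g (X v r) * (prefix_sign R (X v) r * D j (X v)))| <= 4 * S * 2 ^+ (r - d) * (18 * B * spread T / 2 ^+ d).
  (* The increment at level j is of size 2^-(j+1) and depends on j + 1 rows, leaving d - j - 1 free
     signs: the product does not depend on j. *)
  have -> : 18 * B * spread T / 2 ^+ d = (18 * B * (spread T / 2 ^+ j.+1)) / 2 ^+ (d - j.+1) :> R.
    rewrite -{1}(subnKC (ltn_ord j)) exprD invfM; ring.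
  apply: main => // [Y Y' E|Y].
    by rewrite /D (eq_phi E) (@eq_phi Y Y' j)// => i ij; apply: E; exact: ltnW.
  apply: le_trans (Glip _ _ (phi_core _ _ hT) (phi_core _ _ hT)) _.
  by apply: ler_wpM2l; [rewrite mulr_ge0|exact: phi_dist].
have b2 : `|mean (fun v => g (X v r) * (prefix_sign R (X v) r * (G (phi T r (X v)) - G (phi T d (X v)))))| <= S * (18 * B * spread T / 2 ^+ d).
  apply: mean_norm_le => v; rewrite normrM; apply: ler_pM => //.
  rewrite normrM prefix_sign_norm mul1r.
  apply: le_trans (Glip _ _ (phi_core _ _ hT) (phi_core _ _ hT)) _.
  rewrite -[leRHS]mulrA; apply: ler_wpM2l; first by rewrite mulr_ge0.
  by have := phi_dist_add (X v) d (r - d); rewrite subnKC.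
apply: le_trans (ler_normD _ _) _; apply: lerD b2.
apply: le_trans (ler_normD _ _) _; rewrite [leRHS]mulrDr; apply: lerD b0 _.
apply: le_trans (ler_norm_sum _ _ _) _.
apply: le_trans (ler_sum _ (fun j _ => b1 j)) _.
by rewrite sumr_const card_ord -[_ *+ _]mulr_natl mulrCA.
Qed.

(** The two terms with 4 and 100 come from [mean_phi_step], the remaining 13 from
    [centroid_rule]. *)
Definition block_const : R := 4 * spread T + 113 * spread T ^+ 2.

Lemma mean_phi_step r : (d <= r)%N ->
  `|mean (fun v => f (phi T r.+1 (X v)) - f (phi T r (X v)))| <= B * (4 * spread T + 100 * spread T ^+ 2) * (d%:R + 1) / 4 ^+ d.
Proof.
move=> dr; have tay := C2_taylor hT hf nB.
have B0 := C2_norm_bound_ge0 nB; have S0 := spread_ge0 T.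
set G1 := partial 1 0 f in tay; set G2 := partial 0 1 f in tay.
pose g1 xi := (row_shift T xi).1; pose g2 xi := (row_shift T xi).2.
have g1S xi : `|g1 xi| <= spread T by apply: le_trans (row_shift_norm T xi); exact: norm_fst.
have g2S xi : `|g2 xi| <= spread T by apply: le_trans (row_shift_norm T xi); exact: norm_snd.
pose W v := f (phi T r.+1 (X v)) - f (phi T r (X v)) -
  (G1 (phi T r (X v)) * ((phi T r.+1 (X v)).1 - (phi T r (X v)).1) +
   G2 (phi T r (X v)) * ((phi T r.+1 (X v)).2 - (phi T r (X v)).2)).
have WE v : f (phi T r.+1 (X v)) - f (phi T r (X v)) =
  2 ^- r.+1 * (g1 (X v r) * (prefix_sign R (X v) r * G1 (phi T r (X v)))) +
  2 ^- r.+1 * (g2 (X v r) * (prefix_sign R (X v) r * G2 (phi T r (X v)))) + W v.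
  by rewrite /W phiS !pairE /g1 /g2; ring.
have Wle v : `|W v| <= 39 * B * (spread T / 2 ^+ r.+1) ^+ 2.
  have [_ _ _ h] := tay _ _ (phi_core (X v) r hT) (phi_core (X v) r.+1 hT).
  apply: le_trans h _; apply: ler_wpM2l; first by rewrite mulr_ge0.
  by apply: lerXn2r; rewrite ?nnegrE ?divr_ge0 ?exprn_ge0//; exact: phi_dist.
rewrite (eq_mean WE) (meanD _ W) meanD !meanZ.
have GB1 p : triangle_core T p -> `|G1 p| <= B by move=> Up; have [[]] := tay p p Up Up.
have GB2 p : triangle_core T p -> `|G2 p| <= B by move=> Up; have [[]] := tay p p Up Up.
have Gl1 p q : triangle_core T p -> triangle_core T q -> `|G1 q - G1 p| <= 18 * B * `|q - p|.
  by move=> Up Uq; have [] := tay p q Up Uq.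
have Gl2 p q : triangle_core T p -> triangle_core T q -> `|G2 q - G2 p| <= 18 * B * `|q - p|.
  by move=> Up Uq; have [] := tay p q Up Uq.
have m1 := mean_signed_gradient dr GB1 Gl1 g1S.
have m2 := mean_signed_gradient dr GB2 Gl2 g2S.
have m3 := mean_norm_le Wle.
set s := spread T in S0 m1 m2 m3 *.
(* In terms of a and b the displacement is a b / 2. Its factor b cancels the 1 / b in M, so the
   bound is uniform in r; 100 covers 72 d + 18 + 39/4 up to the factor d + 1. *)
pose a := 2 ^- d : R; pose b := 2 ^- (r - d) : R.
have a0 : 0 <= a by rewrite invr_ge0 exprn_ge0.
have b0 : 0 < b by rewrite invr_gt0 exprn_gt0.
have b1 : b <= 1 by rewrite invf_le1 ?exprn_gt0// exprn_ege1// ler1n.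
have E2 : 2 ^- r.+1 = a * b / 2 :> R.
  by rewrite /a /b -{1}(subnKC dr) exprS exprD !invfM; ring.
have E3 : 2 ^+ (r - d) = b^-1 by rewrite invrK.
have E4 : 4 ^- d = a ^+ 2 :> R.
  have -> : 4 = 2 ^+ 2 :> R by ring.
  by rewrite /a -exprM mulnC exprM -exprVn.
rewrite E3 -/a in m1 m2; rewrite E2 in m3 *; rewrite E4.
set M := 4 * s * b^-1 * _ + _ in m1 m2.
have h12 x : `|x| <= M -> `|a * b / 2 * x| <= a * b / 2 * M.
  by move=> h; rewrite normrM ger0_norm ?ler_wpM2l// !mulr_ge0// ltW.
apply: le_trans (ler_normD _ _) _.
apply: le_trans (lerD (le_trans (ler_normD _ _) (lerD (h12 _ m1) (h12 _ m2))) m3) _.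
have -> : a * b / 2 * M + a * b / 2 * M + 39 * B * (s * (a * b / 2)) ^+ 2 =
   B * a ^+ 2 * (4 * s + 72 * s ^+ 2 * d%:R + 18 * s ^+ 2 * b + 39 / 4 * s ^+ 2 * b ^+ 2).
  by rewrite /M; field; rewrite gt_eqF.
have -> : B * (4 * s + 100 * s ^+ 2) * (d%:R + 1) * a ^+ 2 = B * a ^+ 2 * ((4 * s + 100 * s ^+ 2) * (d%:R + 1)) by ring.
apply: ler_wpM2l; first by rewrite mulr_ge0// exprn_ge0.
have s2 : 0 <= s ^+ 2 by rewrite exprn_ge0.
have d0 : 0 <= d%:R :> R by [].
have bb : b ^+ 2 <= 1 by rewrite exprn_ile1// ltW.
have t1 : s ^+ 2 * b <= s ^+ 2 by rewrite ler_piMr.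
have t2 : s ^+ 2 * b ^+ 2 <= s ^+ 2 by rewrite ler_piMr.
have t3 : 0 <= s ^+ 2 * d%:R by rewrite mulr_ge0.
have t4 : 0 <= s * d%:R by rewrite mulr_ge0.
lra.
Qed.

Lemma block_error M : (d <= M)%N ->
  `|mean (fun v => f (phi T M (X v))) - mean_integral T f| <=
  B * block_const * (d%:R + 1) * (M%:R + 1) / 4 ^+ d.
Proof.
move=> dM; have B0 := C2_norm_bound_ge0 nB; have S0 := spread_ge0 T.
pose c := B * (4 * spread T + 100 * spread T ^+ 2) * (d%:R + 1) / 4 ^+ d.
have c0 : 0 <= c by rewrite /c !mulr_ge0 ?addr_ge0 ?mulr_ge0 ?invr_ge0 ?exprn_ge0.
have inc k : `|mean (fun v => f (phi T (d + k) (X v))) - mean (fun v => f (phi T d (X v)))| <= k%:R * c.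
  elim: k => [|k IH]; first by rewrite addn0 subrr normr0 mul0r.
  rewrite addnS; have h := mean_phi_step (leq_addr k d); rewrite -/c in h.
  have E : mean (fun v => f (phi T (d + k).+1 (X v)) - f (phi T (d + k) (X v))) =
    mean (fun v => f (phi T (d + k).+1 (X v))) - mean (fun v => f (phi T (d + k) (X v))).
    by rewrite meanD; congr (_ + _); rewrite -[RHS]mulN1r -meanZ; apply: eq_mean => v; rewrite mulN1r.
  rewrite E in h.
  rewrite -(subrK (mean (fun v => f (phi T (d + k) (X v)))) (mean (fun v => f (phi T (d + k).+1 (X v))))) -addrA.
  by apply: le_trans (ler_normD _ _) _; rewrite -(natr1 k) [leRHS]mulrDl mul1r [leRHS]addrC; apply: lerD.
have cr := centroid_rule d hT hf nB.
have E0 : mean (fun v => f (phi T d (X v))) = iter d (@child_mean R) (f \o @center R) T.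
  exact: (mean_subtriangle_iter T (f \o @center R) (leqnn d)).
rewrite -E0 in cr; have := inc (M - d)%N; rewrite subnKC// => incM.
rewrite -(subrK (mean (fun v => f (phi T d (X v)))) (mean (fun v => f (phi T M (X v))))) -addrA.
apply: le_trans (ler_normD _ _) _; apply: le_trans (lerD incM cr) _.
have kM : (M - d)%:R * c <= M%:R * c by apply: ler_wpM2r => //; rewrite ler_nat leq_subr.
apply: le_trans (lerD kM (lexx _)) _.
rewrite /c /block_const; set s := spread T in S0 *.
have -> : M%:R * (B * (4 * s + 100 * s ^+ 2) * (d%:R + 1) / 4 ^+ d) + 13 * B * s ^+ 2 / 4 ^+ d =
  (B / 4 ^+ d) * (M%:R * ((4 * s + 100 * s ^+ 2) * (d%:R + 1)) + 13 * s ^+ 2) by ring.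
have -> : B * (4 * s + 113 * s ^+ 2) * (d%:R + 1) * (M%:R + 1) / 4 ^+ d =
  (B / 4 ^+ d) * ((4 * s + 113 * s ^+ 2) * (d%:R + 1) * (M%:R + 1)) by ring.
apply: ler_wpM2l; first by rewrite mulr_ge0// invr_ge0 exprn_ge0.
have d0 : 0 <= d%:R :> R by []. have M0 : 0 <= M%:R :> R by [].
have s2 : 0 <= s ^+ 2 by rewrite exprn_ge0.
have dm : 0 <= (d%:R + 1) * M%:R :> R by rewrite mulr_ge0// addr_ge0.
have t1 : 0 <= s ^+ 2 * ((d%:R + 1) * M%:R) by rewrite mulr_ge0.
have t2 : 0 <= s * (d%:R + 1) by rewrite mulr_ge0// addr_ge0.
have t3 : 0 <= s ^+ 2 * d%:R by rewrite mulr_ge0.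
lra.
Qed.

End Block.

End Fourier.

(** * Digital sequences *)

Section Digital.

(** Linear independence over F_2 of the 2 d vectors formed by the first d rows of both matrices, cut
    to m columns. *)
Definition rows_independent (C1 C2 : infmx) m d := forall w1 w2 : nat -> 'F_2,
  (forall l, (l < m)%N -> \sum_(i < d) C1 i l * w1 i + \sum_(i < d) C2 i l * w2 i = 0) ->
  forall i, (i < d)%N -> w1 i = 0 /\ w2 i = 0.

Lemma bigminn_le (I : eqType) (s : seq I) (P : pred I) (F : I -> nat) x i :
  i \in s -> P i -> (\big[minn/x]_(j <- s | P j) F j <= F i)%N.
Proof.
elim: s => // j s IH; rewrite inE => /predU1P[<- Pi|si Pi]; rewrite big_cons.
  by rewrite Pi geq_minl.
by case: ifP => _; [rewrite geq_min IH ?orbT|exact: IH].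
Qed.

Lemma sum_ord_trunc (F : nat -> 'F_2) d n : (d <= n)%N ->
  \sum_(i < n) (if (i < d)%N then F i else 0) = \sum_(i < d) F i.
Proof. by move=> dn; rewrite [RHS](big_ord_widen n (fun i => F i) dn) [RHS]big_mkcond. Qed.

(** A relation among these rows is an element of the dual net supported on the first d rows, so its
    [mu1] is at most 2 * d, while nonzero elements have [mu1] at least m - t + 1 > 2 * d. *)
Lemma digital_net_rows_independent (C1 C2 : infmx) t m n d :
  digital_net t (submatrix n m C1) (submatrix n m C2) -> (2 * d + t <= m)%N ->
  rows_independent C1 C2 m d.
Proof.
move=> [mn mu] dt w1 w2 E.
have dn : (d <= n)%N by lia.
pose k (w : nat -> 'F_2) : 'cV['F_2]_n := \col_(i < n) (if (i < d)%N then w i else 0).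
have kd w : (mu1_col (k w) <= d)%N.
  by apply/bigmax_leqP => i; rewrite mxE; case: ifP => //; rewrite eqxx.
have k0 w i : k w = 0 -> (i < d)%N -> w i = 0.
  move=> /matrixP kw0 id; have := kw0 (Ordinal (leq_trans id dn)) 0.
  by rewrite !mxE /= id.
have Kin : (k w1, k w2) \in dual_net (submatrix n m C1) (submatrix n m C2).
  rewrite inE; apply/eqP/matrixP => l j; rewrite !mxE /=.
  rewrite -[RHS](E l (ltn_ord l)); congr (_ + _).
    rewrite -(sum_ord_trunc (fun i => C1 i l * w1 i) dn); apply: eq_bigr => i _.
    by rewrite !mxE; case: ifP; rewrite ?mulr0.
  rewrite -(sum_ord_trunc (fun i => C2 i l * w2 i) dn); apply: eq_bigr => i _.
  by rewrite !mxE; case: ifP; rewrite ?mulr0.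
have [/eqP[kw1 kw2] i id|K0] := boolP ((k w1, k w2) == (0, 0)); first by split; apply: k0.
have : (mu1_dual (submatrix n m C1) (submatrix n m C2) <= mu1 (k w1, k w2))%N.
  by apply: bigminn_le; [exact: mem_index_enum|rewrite finset.in_setD1 K0 Kin].
by have := kd w1; have := kd w2; rewrite /mu1 /=; lia.
Qed.

(** Counting from 0, column 2 i isolates [w1 i] and column 2 i + 1 isolates [w2 i]. *)
Lemma interlaced_rows_independent m : rows_independent interlaced1 interlaced2 m (m./2).
Proof.
move=> w1 w2 E i id.
have i2 : (2 * i < m)%N by lia.
have i3 : (2 * i + 1 < m)%N by lia.
split.
  have := E _ i2; rewrite (bigD1 (Ordinal id))//= big1 ?addr0 => [|j /negP ji]; last first.
    rewrite /interlaced1; case: eqP => [e|]; last by rewrite mul0r.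
    by case: ji; apply/eqP/val_inj => /=; lia.
  rewrite big1 ?addr0 => [|j _]; last first.
    by rewrite /interlaced2; case: eqP => [|]; [lia|rewrite mul0r].
  by rewrite /interlaced1; case: eqP => [_|]; [rewrite mul1r|lia].
have := E _ i3; rewrite addrC (bigD1 (Ordinal id))//= big1 ?addr0 => [|j /negP ji]; last first.
  rewrite /interlaced2; case: eqP => [e|]; last by rewrite mul0r.
  by case: ji; apply/eqP/val_inj => /=; lia.
rewrite big1 ?addr0 => [|j _]; last first.
  by rewrite /interlaced1; case: eqP => [|]; [lia|rewrite mul0r].
by rewrite /interlaced2; case: eqP => [_|]; [rewrite mul1r|lia].
Qed.

(** The stacked matrix of 2 d independent rows has a right inverse; its columns are the dual
    vectors. *)
Lemma rows_independent_dual_basis (C1 C2 : infmx) m d : rows_independent C1 C2 m d ->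
  exists e1 e2 : nat -> 'cV['F_2]_m, forall i k, (i < d)%N -> (k < d)%N ->
  [/\ \sum_(l < m) C1 k l * e1 i l 0 = (k == i)%:R, \sum_(l < m) C2 k l * e1 i l 0 = 0,
      \sum_(l < m) C1 k l * e2 i l 0 = 0 & \sum_(l < m) C2 k l * e2 i l 0 = (k == i)%:R].
Proof.
move=> ind.
pose A := col_mx (submatrix d m C1) (submatrix d m C2).
have /row_freeP[B AB] : row_free A.
  apply: inj_row_free => v vA.
  pose w (v : 'rV['F_2]_d) (i : nat) : 'F_2 := if insub i is Some j then v 0 j else 0.
  have wE (u : 'rV['F_2]_d) (i : 'I_d) : w u i = u 0 i by rewrite /w valK.
  have E l : (l < m)%N -> \sum_(i < d) C1 i l * w (lsubmx v) i + \sum_(i < d) C2 i l * w (rsubmx v) i = 0.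
    move=> lm; move: vA; rewrite -[v]hsubmxK mul_row_col => /matrixP /(_ 0 (Ordinal lm)).
    rewrite !mxE hsubmxK => E0; rewrite -[RHS]E0; congr (_ + _); apply: eq_bigr => i _.
      by rewrite wE [RHS]mulrC [submatrix _ _ _ _ _]mxE.
    by rewrite wE [RHS]mulrC [submatrix _ _ _ _ _]mxE.
  rewrite -[v]hsubmxK; have z := ind _ _ E.
  have -> : lsubmx v = 0 by apply/rowP => i; have [+ _] := z _ (ltn_ord i); rewrite wE => ->; rewrite mxE.
  have -> : rsubmx v = 0 by apply/rowP => i; have [_ +] := z _ (ltn_ord i); rewrite wE => ->; rewrite mxE.
  exact: row_mx0.
have Au (i : 'I_d) l : A (lshift d i) l = C1 i l by rewrite /A col_mxEu mxE.
have Ad (i : 'I_d) l : A (rshift d i) l = C2 i l by rewrite /A col_mxEd mxE.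
(* [inord] requires an inhabited ordinal type, so d = 0 is treated apart. *)
case: d A B AB Au Ad {ind} => [|d] A B AB Au Ad; first by exists (fun=> 0), (fun=> 0).
exists (fun i => col (lshift d.+1 (inord i : 'I_d.+1)) B), (fun i => col (rshift d.+1 (inord i : 'I_d.+1)) B).
move=> i k id kd.
have AE (r c : 'I_(d.+1 + d.+1)) : \sum_(l < m) A r l * B l c = (r == c)%:R.
  by move/matrixP/(_ r c): AB; rewrite !mxE.
have kE : (inord k : 'I_d.+1) = Ordinal kd by apply: val_inj; rewrite /= inordK.
have iE : (inord i : 'I_d.+1) = Ordinal id by apply: val_inj; rewrite /= inordK.
split.
- have := AE (lshift _ (inord k)) (lshift _ (inord i)).
  rewrite eq_lshift kE iE -val_eqE /= => <-; apply: eq_bigr => l _.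
  by rewrite Au [col _ _ _ _]mxE.
- have := AE (rshift _ (inord k)) (lshift _ (inord i)).
  rewrite eq_rlshift => AE0; apply: etrans AE0; apply: eq_bigr => l _.
  by rewrite Ad [col _ _ _ _]mxE kE.
- have := AE (lshift _ (inord k)) (rshift _ (inord i)).
  rewrite eq_lrshift => AE0; apply: etrans AE0; apply: eq_bigr => l _.
  by rewrite Au [col _ _ _ _]mxE kE.
- have := AE (rshift _ (inord k)) (rshift _ (inord i)).
  rewrite eq_rshift kE iE -val_eqE /= => <-; apply: eq_bigr => l _.
  by rewrite Ad [col _ _ _ _]mxE.
Qed.

(* The rows of the points of index 2 ^ m * q + h, h < 2 ^ m, as affine functions of the digits v of h. *)
Definition block_rows (C1 C2 : infmx) m (c : nat -> row2) (v : 'cV['F_2]_m) (k : nat) : row2 :=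
  (\sum_(l < m) C1 k l * v l 0 + (c k).1, \sum_(l < m) C2 k l * v l 0 + (c k).2).

Lemma affine_form_sum m (C : nat -> 'F_2) (c : 'F_2) :
  affine_form (fun v : 'cV['F_2]_m => \sum_(l < m) C l * v l 0 + c).
Proof.
move=> u v; rewrite [X in _ = _ + (X + _)]big1 ?add0r => [|l _]; last by rewrite mxE mulr0.
have -> : \sum_(l < m) C l * (u + v) l 0 = \sum_(l < m) C l * u l 0 + \sum_(l < m) C l * v l 0.
  by rewrite -big_split; apply: eq_bigr => l _; rewrite mxE mulrDr.
have h := F2_addxx c; rewrite -[LHS]addr0 -h; ring.
Qed.

(** Adding [u.1 *: e1 i + u.2 *: e2 i] to the digits adds u to row i and fixes the other rows of
    index below d; the offset c plays the part of the constant term. *)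
Lemma affine_block_block_rows (C1 C2 : infmx) m c d : rows_independent C1 C2 m d ->
  affine_block (block_rows C1 C2 c : 'cV['F_2]_m -> nat -> row2) d.
Proof.
move=> /rows_independent_dual_basis[e1 [e2 He]].
split; first by move=> i; split; exact: affine_form_sum.
move=> i id; exists (fun u => u.1 *: e1 i + u.2 *: e2 i).
  by elim/row2_ind; rewrite /= ?scale0r ?scale1r ?addr0 ?add0r.
move=> k v u kd; have [h11 h21 h12 h22] := He i k id kd.
have lin (C : infmx) (a b : 'F_2) : \sum_(l < m) C k l * e1 i l 0 = a -> \sum_(l < m) C k l * e2 i l 0 = b ->
  \sum_(l < m) C k l * (v + (u.1 *: e1 i + u.2 *: e2 i)) l 0 =
  \sum_(l < m) C k l * v l 0 + (u.1 * a + u.2 * b).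
  move=> <- <-; rewrite !mulr_sumr -!big_split; apply: eq_bigr => l _ /=.
  by rewrite !mxE; ring.
rewrite /block_rows (lin C1 _ _ h11 h12) (lin C2 _ _ h21 h22).
case: eqP => _; apply: injective_projections; rewrite /=; ring.
Qed.

Lemma bit0 h : bit h 0 = (h %% 2)%N%:R.
Proof. by rewrite /bit expn0 divn1. Qed.

Lemma bitS h l : bit h l.+1 = bit (h %/ 2) l.
Proof. by rewrite /bit expnS divnMA. Qed.

Lemma bit_inj m h h' : (h < 2 ^ m)%N -> (h' < 2 ^ m)%N -> (forall l, (l < m)%N -> bit h l = bit h' l) -> h = h'.
Proof.
elim: m h h' => [|m IH] h h'; first by rewrite expn0; case: h; case: h'.
rewrite expnS => hm hm' E.
have h2 : (h %/ 2 = h' %/ 2)%N.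
  by apply: IH => [||l lm]; [lia|lia|rewrite -!bitS; exact: E].
have := E 0%N isT; rewrite !bit0.
have a1 : (h %% 2 < 2)%N by rewrite ltn_mod.
have a2 : (h' %% 2 < 2)%N by rewrite ltn_mod.
have F2nat x : (x < 2)%N -> ((x%:R : 'F_2) : nat) = x by case: x => [|[|]].
by move=> /(congr1 val) /=; rewrite !F2nat//; lia.
Qed.

Lemma bit_small h l : (h < 2 ^ l)%N -> bit h l = 0.
Proof. by move=> hl; rewrite /bit divn_small. Qed.

Lemma bit_add_low m q h l : (l < m)%N -> bit (2 ^ m * q + h) l = bit h l.
Proof.
move=> lm; rewrite /bit.
have -> : (2 ^ m * q = (2 ^ (m - l.+1) * q * 2) * 2 ^ l)%N.
  by rewrite -{1}(subnKC lm) expnD expnS; ring.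
by rewrite divnMDl ?expn_gt0// modnMDl.
Qed.

Lemma bit_add_high m q h l : (h < 2 ^ m)%N -> (m <= l)%N -> bit (2 ^ m * q + h) l = bit (2 ^ m * q) l.
Proof.
move=> hm ml; rewrite /bit -(subnKC ml) expnD !divnMA.
by rewrite mulnC divnMDl ?expn_gt0// (divn_small hm) addn0 mulnK ?expn_gt0.
Qed.

Definition bitvec m h : 'cV['F_2]_m := \col_(l < m) bit h l.

(** The digit map is injective between two sets of 2^m elements, hence bijective. *)
Lemma sum_bitvec (R : nmodType) m (F : 'cV['F_2]_m -> R) :
  \sum_(v : 'cV['F_2]_m) F v = \sum_(h < 2 ^ m) F (bitvec m h).
Proof.
have inj : injective (fun h : 'I_(2 ^ m) => bitvec m h).
  move=> h h' E; apply: val_inj; apply: (@bit_inj m) => [||l lm]; [exact: ltn_ord|exact: ltn_ord|].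
  by move/matrixP/(_ (Ordinal lm) 0): E; rewrite !mxE.
have card : (#|'cV['F_2]_m| <= #|'I_(2 ^ m)|)%N.
  by rewrite card_mx card_ord card_Fp// muln1.
rewrite (reindex (fun h : 'I_(2 ^ m) => bitvec m h))//.
exact: onW_bij (inj_card_bij inj card).
Qed.

Lemma sum_bits (C : infmx) k h L : (h < 2 ^ L)%N ->
  \sum_(l < h) C k l * bit h l = \sum_(l < L) C k l * bit h l.
Proof.
have ext n n' : (n <= n')%N -> (h < 2 ^ n)%N -> \sum_(l < n) C k l * bit h l = \sum_(l < n') C k l * bit h l.
  move=> nn' hn; rewrite -!(big_mkord predT (fun l => C k l * bit h l)) (big_cat_nat (leq0n n) nn') /=.
  rewrite [X in _ = _ + X]big_nat [X in _ = _ + X]big1 ?addr0// => l /andP[nl _].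
  by rewrite bit_small ?mulr0//; apply: leq_trans hn _; rewrite leq_exp2l.
move=> hL; case: (leqP h L) => [hh|/ltnW Lh]; first by apply: ext => //; exact: ltn_expl.
by symmetry; apply: ext.
Qed.

(** The m low digits are those of h, the others those of 2^m q; the latter contribute a constant
    offset on the block. *)
Lemma digital_point_block (C1 C2 : infmx) m M q h : (h < 2 ^ m)%N -> (m <= M)%N -> (2 ^ m * q + h < 2 ^ M)%N ->
  digital_point C1 C2 (2 ^ m * q + h) =
  block_rows C1 C2 (fun k => (\sum_(m <= l < M) C1 k l * bit (2 ^ m * q) l,
                              \sum_(m <= l < M) C2 k l * bit (2 ^ m * q) l)) (bitvec m h).
Proof.
move=> hm mM hM; apply/funext => k; rewrite /digital_point /block_rows !(sum_bits _ _ hM).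
have E (C : infmx) : \sum_(l < M) C k l * bit (2 ^ m * q + h) l =
    \sum_(l < m) C k l * bitvec m h l 0 + \sum_(m <= l < M) C k l * bit (2 ^ m * q) l.
  rewrite -(big_mkord predT (fun l => C k l * bit (2 ^ m * q + h) l)) (big_cat_nat (leq0n m) mM) /=.
  congr (_ + _).
    by rewrite big_mkord; apply: eq_bigr => l _; rewrite mxE bit_add_low.
  by rewrite !big_nat; apply: eq_bigr => l /andP[ml _]; rewrite bit_add_high.
by rewrite !E.
Qed.

Lemma rows_vanish_upper (C1 C2 : infmx) M h : upper_triangular C1 -> upper_triangular C2 -> (h < 2 ^ M)%N ->
  rows_vanish_from (digital_point C1 C2 h) M.
Proof.
move=> u1 u2 hM k Mk; rewrite /digital_point !(sum_bits _ _ hM).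
by rewrite !big1// => l _; rewrite ?u1 ?u2 ?mul0r//; exact: leq_trans Mk.
Qed.

Lemma phi_vanish (R : realType) (T : triangle R) X n M : rows_vanish_from X n -> (n <= M)%N ->
  phi T M X = phi T n X.
Proof.
move=> Xn /subnKC <-; elim: (M - n)%N => [|k IH]; first by rewrite addn0.
by rewrite addnS phiS Xn ?leq_addr// /row_shift eqxx scaler0 addr0.
Qed.

(** All points of a block can thus be taken at one level M, although [nu] varies; the default value
    of [nu] is avoided because the rows vanish from M on. *)
Lemma phi_nu (R : realType) (T : triangle R) X M : rows_vanish_from X M -> phi T (nu X) X = phi T M X.
Proof.
move=> XM.
have ex : exists n, `[< rows_vanish_from X n >] by exists M; apply/asboolP.
have [n /asboolP Xn nmin] := ex_minnP ex.
pose S := [set n | rows_vanish_from X n /\ forall n', rows_vanish_from X n' -> (n <= n')%N].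
have [nuX numin] : S (nu X).
  apply: xgetPex; exists n; split=> // n' Xn'.
  by apply: nmin; apply/asboolP.
by symmetry; apply: phi_vanish => //; exact: numin.
Qed.

End Digital.

(** * Error bounds *)

Lemma balanced_rows_independent (C1 C2 : infmx) :
  (exists t : nat, [/\ digital_ts_sequence t C1 C2, upper_triangular C1 & upper_triangular C2])
  \/ (C1 = interlaced1 /\ C2 = interlaced2) ->
  [/\ upper_triangular C1, upper_triangular C2 & exists t, forall m, exists d,
    [/\ (m <= 2 * d + t)%N, (d <= m)%N & rows_independent C1 C2 m d]].
Proof.
case=> [[t [[_ _ net] u1 u2]]|[-> ->]]; split => //.
(* Halving m - t may lose one unit, which [t.+1] absorbs; for m <= t no row is claimed to be
   free. *)
- exists t.+1 => m; case: (leqP m t) => mt.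
    by exists 0%N; split => //; lia.
  exists ((m - t)./2); split; [lia|lia|].
  have [n [_ _ hn]] := net m mt.
  by apply: digital_net_rows_independent hn _; lia.
- by move=> k l lk; rewrite /interlaced1; case: eqP => //; lia.
- by move=> k l lk; rewrite /interlaced2; case: eqP => //; lia.
exists 1%N => m; exists (m./2); split; [lia|lia|exact: interlaced_rows_independent].
Qed.

Lemma log2_ge (R : realType) N : (2 <= N)%N -> 1 <= log2 (N%:R : R) /\ (trunc_log 2 N)%:R <= log2 (N%:R : R).
Proof.
move=> N2; have ln2 : 0 < ln (2 : R) by rewrite ln_gt0// ltr1n.
have key k : (2 ^ k <= N)%N -> k%:R <= log2 (N%:R : R).
  move=> kN; rewrite /log2 ler_pdivlMr// mulr_natl -lnXn// -natrX ler_ln ?posrE ?ltr0n ?expn_gt0//.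
    by rewrite ler_nat.
  by apply: leq_trans N2.
by split; [exact: (key 1%N N2)|apply: key; apply: trunc_logP => //; apply: leq_trans N2].
Qed.

Section Assembly.
Variables (R : realType) (T : triangle R) (C1 C2 : infmx) (t : nat).
Hypotheses (hT : nondegenerate T) (u1 : upper_triangular C1) (u2 : upper_triangular C2).
Hypothesis bal : forall m, exists d, [/\ (m <= 2 * d + t)%N, (d <= m)%N & rows_independent C1 C2 m d].
Variables (f : R * R -> R) (B : R).
Hypotheses (hf : C2_on (triangle_set T) f) (nB : (C2_norm (triangle_set T) f <= B%:E)%E).

Local Notation K := (block_const T * 2 ^+ t : R).
Let x := triangle_sequence T C1 C2.
Let I := mean_integral T f.

Lemma block_const_ge0 : 0 <= block_const T.
Proof. by rewrite /block_const addr_ge0// mulr_ge0// ?exprn_ge0// spread_ge0. Qed.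

Lemma triangle_sequenceE h M : (h < 2 ^ M)%N -> x h = phi T M (digital_point C1 C2 h).
Proof. by move=> hM; rewrite /x /triangle_sequence (phi_nu _ (rows_vanish_upper u1 u2 hM)). Qed.

(** This is [block_error] times the length of the block: m <= 2 d + t gives 2^m / 4^d <= 2^t, so the
    length survives only through the factor m + 1. *)
Lemma block_sum m M q : (m <= M)%N -> (2 ^ m * q.+1 <= 2 ^ M)%N ->
  `|\sum_(h < 2 ^ m) (f (x (2 ^ m * q + h)) - I)| <= B * K * (m%:R + 1) * (M%:R + 1).
Proof.
move=> mM qM; have B0 : 0 <= B := C2_norm_bound_ge0 nB; have k0 := block_const_ge0.
have [d [md dm ind]] := bal m.
pose c := fun k => (\sum_(m <= l < M) C1 k l * bit (2 ^ m * q) l, \sum_(m <= l < M) C2 k l * bit (2 ^ m * q) l) : row2.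
pose X := block_rows C1 C2 c : 'cV['F_2]_m -> nat -> row2.
have bX : affine_block X d := affine_block_block_rows c ind.
have := block_error bX hT hf nB (leq_trans dm mM).
have cardV : #|{: 'cV['F_2]_m}|%:R = 2 ^+ m :> R by rewrite card_mx card_Fp// muln1 natrX.
have -> : mean (fun v => f (phi T M (X v))) - mean_integral T f =
    2 ^- m * \sum_(h < 2 ^ m) (f (x (2 ^ m * q + h)) - I).
  rewrite /mean cardV sum_bitvec sumrB sumr_const card_ord mulrBr; congr (_ - _).
    congr (_ * _); apply: eq_bigr => h _.
    have hM : (2 ^ m * q + h < 2 ^ M)%N.
      by apply: leq_trans qM; rewrite mulnS addnC ltn_add2r.
    by rewrite (triangle_sequenceE hM) (digital_point_block _ _ (ltn_ord h) mM hM).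
  by rewrite -[I *+ _]mulr_natl natrX mulrA mulVf ?mul1r// expf_neq0.
rewrite normrM ger0_norm ?invr_ge0 ?exprn_ge0// ler_pdivrMl ?exprn_gt0// => h.
apply: le_trans h _.
have E4 : 4 ^+ d = 2 ^+ (2 * d) :> R by rewrite exprM; congr (_ ^+ _); ring.
have h2 : 2 ^+ m / 4 ^+ d <= 2 ^+ t :> R.
  by rewrite E4 ler_pdivrMr ?exprn_gt0// -exprD ler_eXn2l ?ltr1n// addnC.
have -> : 2 ^+ m * (B * block_const T * (d%:R + 1) * (M%:R + 1) / 4 ^+ d) =
  (B * block_const T) * (2 ^+ m / 4 ^+ d) * (d%:R + 1) * (M%:R + 1) by ring.
rewrite [B * K]mulrA; apply: ler_wpM2r; first by rewrite addr_ge0.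
apply: ler_pM.
- by rewrite !mulr_ge0// ?invr_ge0 exprn_ge0.
- by rewrite addr_ge0.
- by apply: ler_wpM2l => //; rewrite mulr_ge0.
- by rewrite lerD2r ler_nat.
Qed.

Lemma sum_error N M : (N < 2 ^ M)%N ->
  `|\sum_(h < N) (f (x h) - I)| <= M%:R * (B * K * M%:R * (M%:R + 1)).
Proof.
move=> NM; have B0 : 0 <= B := C2_norm_bound_ge0 nB; have k0 := block_const_ge0.
pose S n := \sum_(0 <= h < n) (f (x h) - I).
rewrite -(big_mkord predT (fun h => f (x h) - I)) -/(S N).
(* Induction on the number j of leading digits of N (written with M digits) that are kept. A new
   digit 1 appends one block of length 2^k, placed at q' = 2 q; a digit 0 appends nothing. *)
suff H j : (j <= M)%N -> `|S (2 ^ (M - j) * (N %/ 2 ^ (M - j)))%N| <= j%:R * (B * K * M%:R * (M%:R + 1)).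
  by have := H M (leqnn M); rewrite subnn expn0 mul1n divn1.
elim: j => [_|j IH jM].
  by rewrite subn0 divn_small// muln0 /S big_geq// normr0 mul0r.
set k := (M - j.+1)%N; have kE : (M - j = k.+1)%N by rewrite /k; lia.
have kM : (k.+1 <= M)%N by lia.
have IHj := IH (ltnW jM); rewrite kE in IHj.
set q := (N %/ 2 ^ k.+1)%N in IHj.
have Eq : (N %/ 2 ^ k = 2 * q + (N %/ 2 ^ k) %% 2)%N.
  by rewrite /q expnSr divnMA {1}(divn_eq (N %/ 2 ^ k) 2) mulnC.
have bk : 0 <= B * K by rewrite !mulr_ge0// exprn_ge0.
have e0 : 0 <= B * K * M%:R * (M%:R + 1) by apply: mulr_ge0; [rewrite mulr_ge0|rewrite addr_ge0].
rewrite -(natr1 j) mulrDl mul1r Eq.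
have [b0|b1] : ((N %/ 2 ^ k) %% 2 = 0 \/ (N %/ 2 ^ k) %% 2 = 1)%N by lia.
  rewrite b0 addn0 mulnA -expnSr; apply: le_trans IHj _.
  by rewrite lerDl.
rewrite b1 mulnDr muln1 mulnA -expnSr.
have qM : (2 ^ k * (2 * q).+1 <= 2 ^ M)%N.
  have Nk : (N %/ 2 ^ k = (2 * q).+1)%N by rewrite Eq b1 addn1.
  by apply: leq_trans (ltnW NM); rewrite [X in (_ <= X)%N](divn_eq N (2 ^ k)) Nk mulnC leq_addr.
have E : S (2 ^ k.+1 * q + 2 ^ k)%N = S (2 ^ k.+1 * q)%N + \sum_(h < 2 ^ k) (f (x (2 ^ k * (2 * q) + h)) - I).
  rewrite /S (@big_cat_nat _ _ _ (2 ^ k.+1 * q)%N) ?leq_addr//=; congr (_ + _).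
  rewrite -{1}[(2 ^ k.+1 * q)%N]add0n big_addn addKn big_mkord; apply: eq_bigr => h _.
  by rewrite mulnA -expnSr addnC.
rewrite E; apply: le_trans (ler_normD _ _) _; apply: lerD IHj _.
apply: le_trans (block_sum (ltnW kM) qM) _.
apply: ler_wpM2r; first by rewrite addr_ge0.
apply: ler_wpM2l; first by rewrite !mulr_ge0 ?exprn_ge0.
by rewrite natr1 ler_nat.
Qed.

Lemma quadratureE N : (0 < N)%N -> quadrature f x N - I = N%:R^-1 * \sum_(h < N) (f (x h) - I).
Proof.
move=> N0; rewrite /quadrature sumrB sumr_const card_ord mulrBr; congr (_ - _).
by rewrite -[I *+ _]mulr_natl mulrA mulVf ?mul1r// pnatr_eq0 -lt0n.
Qed.

(** The first 2^m points form a single block, with q = 0 and M = m; 4 comes from m + 1 <= 2 m. *)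
Lemma quadrature_pow2_error m : (1 <= m)%N ->
  `|quadrature f x (2 ^ m)%N - I| <= 4 * K * B * (m%:R ^+ 2 / 2 ^+ m).
Proof.
move=> m1; have B0 : 0 <= B := C2_norm_bound_ge0 nB; have k0 := block_const_ge0.
rewrite quadratureE ?expn_gt0// normrM ger0_norm ?invr_ge0// ler_pdivrMl ?ltr0n ?expn_gt0//.
have := @block_sum m m 0%N (leqnn m); rewrite muln0 muln1 => /(_ (leqnn _)) h.
apply: (le_trans (y := B * K * (m%:R + 1) * (m%:R + 1))).
  by apply: le_trans h; rewrite le_eqVlt; apply/orP; left; apply/eqP; congr `|_|; apply: eq_bigr => i _; rewrite add0n.
rewrite natrX.
have -> : 2 ^+ m * (4 * K * B * (m%:R ^+ 2 / 2 ^+ m)) = B * K * (2 * m%:R) * (2 * m%:R).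
  by field; rewrite expf_neq0.
have h2 : m%:R + 1 <= 2 * m%:R :> R by have : 1 <= m%:R :> R by [rewrite ler1n]; lra.
have bk : 0 <= B * K by rewrite !mulr_ge0// exprn_ge0.
have a0 : 0 <= m%:R + 1 :> R by rewrite addr_ge0.
by apply: ler_pM => //; [rewrite mulr_ge0|exact: ler_wpM2l].
Qed.

(** With M = [(trunc_log 2 N).+1] at most 2 log2 N, the bound M^2 (M + 1) <= 2 M^3 gives 16 = 2 *
    2^3. *)
Lemma quadrature_error N : (2 <= N)%N ->
  `|quadrature f x N - I| <= 16 * K * B * (log2 N%:R ^+ 3 / N%:R).
Proof.
move=> N2; have B0 : 0 <= B := C2_norm_bound_ge0 nB; have k0 := block_const_ge0.
have N0 : (0 < N)%N by apply: leq_trans N2.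
have [l1 lt] := log2_ge R N2.
rewrite quadratureE// normrM ger0_norm ?invr_ge0// ler_pdivrMl ?ltr0n//.
have NM : (N < 2 ^ (trunc_log 2 N).+1)%N by exact: trunc_log_ltn.
apply: le_trans (sum_error NM) _.
set M := (trunc_log 2 N).+1.
have M1 : 1 <= M%:R :> R by rewrite ler1n.
have M2 : M%:R <= 2 * log2 (N%:R : R) by rewrite /M -natr1; lra.
set L := log2 _ in l1 lt M2 *.
have -> : N%:R * (16 * K * B * (L ^+ 3 / N%:R)) = 2 * (B * K) * (2 * L) ^+ 3.
  by field; rewrite pnatr_eq0 -lt0n.
have bk : 0 <= B * K by rewrite !mulr_ge0// exprn_ge0.
apply: (le_trans (y := 2 * (B * K) * M%:R ^+ 3)).
  have -> : M%:R * (B * K * M%:R * (M%:R + 1)) = (B * K * (M%:R * M%:R)) * (M%:R + 1) by ring.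
  have -> : 2 * (B * K) * M%:R ^+ 3 = (B * K * (M%:R * M%:R)) * (2 * M%:R) by ring.
  by apply: ler_wpM2l; [rewrite !mulr_ge0|lra].
by apply: ler_wpM2l; [rewrite mulr_ge0|apply: lerXn2r; rewrite ?nnegrE//; lra].
Qed.

End Assembly.

Theorem theorem2 (R : realType) (T : triangle R) (hT : nondegenerate T)
    (C1 C2 : infmx)
    (hS : (exists t : nat, [/\ digital_ts_sequence t C1 C2,
                              upper_triangular C1 & upper_triangular C2])
          \/ (C1 = interlaced1 /\ C2 = interlaced2)) :
  exists C : R, 0 < C /\
    forall f : R * R -> R, C2_on (triangle_set T) f ->
      (forall N : nat, (2 <= N)%N ->
         (`|quadrature f (triangle_sequence T C1 C2) N - mean_integral T f|%:E
          <= C%:E * C2_norm (triangle_set T) f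
             * (log2 N%:R ^+ 3 / N%:R)%:E)%E) /\
      (forall m : nat, (1 <= m)%N ->
         (`|quadrature f (triangle_sequence T C1 C2) (2 ^ m)%N
            - mean_integral T f|%:E
          <= C%:E * C2_norm (triangle_set T) f
             * (m%:R ^+ 2 / 2 ^+ m)%:E)%E).
Proof.
have [u1 u2 [t bal]] := balanced_rows_independent hS.
have k0 := block_const_ge0 T.
have K0 : 0 <= block_const T * 2 ^+ t by rewrite mulr_ge0// exprn_ge0.
(* The 1 makes C positive from the nonnegativity of [block_const] alone. *)
pose C := 16 * (block_const T * 2 ^+ t) + 1.
have C0 : 0 < C by rewrite /C; lra.
exists C; split=> // f hf.
have wpos N : (2 <= N)%N -> 0 < log2 (N%:R : R) ^+ 3 / N%:R.
  move=> N2; have [l1 _] := log2_ge R N2.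
  by rewrite divr_gt0 ?ltr0n ?(leq_trans _ N2)// exprn_gt0//; lra.
have mpos m : (1 <= m)%N -> 0 < m%:R ^+ 2 / 2 ^+ m :> R.
  by move=> m1; rewrite divr_gt0 ?exprn_gt0// ltr0n.
have := C2_norm_ge0 (triangle_set T) f.
(* A norm equal to +oo makes the right-hand sides +oo, since C and both rates are strictly positive;
   -oo is excluded by nonnegativity. *)
case nE : (C2_norm (triangle_set T) f) => [B| |] // nB0.
  have nB : (C2_norm (triangle_set T) f <= B%:E)%E by rewrite nE.
  have B0 : 0 <= B by rewrite -lee_fin.
  split=> [N N2|m m1]; rewrite -!EFinM lee_fin.
    apply: le_trans (quadrature_error hT u1 u2 bal hf nB N2) _.
    apply: ler_wpM2r; first exact/ltW/wpos.
    by apply: ler_wpM2r => //; rewrite /C; lra.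
  apply: le_trans (quadrature_pow2_error hT u1 u2 bal hf nB m1) _.
  apply: ler_wpM2r; first exact/ltW/mpos.
  by apply: ler_wpM2r => //; rewrite /C; lra.
by split=> [N N2|m m1]; rewrite gt0_muley ?lte_fin// gt0_mulye ?lte_fin ?wpos ?mpos// leey.
Qed.
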